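(* Let $M$ be a smooth manifold, $(V,\partial)$ a cochain complex and $\beta=\beta^1+\beta^2+\cdots$ a well behaved representation up to homotopy of $\pi_\infty(M)$ on $(V,\partial)$. Then there is a representation $\mathsf{T}_{\le 2}(\beta)$ of the fundamental $2$-groupoid of $M$ in the Lie crossed module $\mathsf{GL}(V)$ given as follows: (i) if $\gamma$ is a path in $M$, then $(\mathsf{T}_{\le 2}\beta)(\gamma):=\beta^1(\gamma^{-1})$; (ii) if $\Gamma$ is a $2$-path in $M$, then $(\mathsf{T}_{\le 2}\beta)(\Gamma)$ is the element of $\mathsf{GL}^{-1}(V)$ represented by $(\beta^2(\Gamma_b)-\beta^2(\Gamma_a))\,\beta^1(\Gamma_1^{-1})$.
   Context: **Conventions.** A cochain complex $(V,\partial)$ is a finite-dimensional $\mathbb{Z}$-graded real vector space with a differential of degree $+1$. $\mathrm{End}^k(V)$ is the space of degree $k$ linear endomorphisms; for $\varphi\in\mathrm{End}^k(V)$, $[\partial,\varphi]=\partial\varphi-(-1)^k\varphi\partial$. $I=[0,1]$; on $I^2$ the horizontal coordinate is $t$ and the vertical one is $s$, written $(t,s)$. $\Delta_k=\{(t_1,\dots,t_k)\in\mathbb{R}^k:1\ge t_1\ge\cdots\ge t_k\ge0\}$. Paths, simplices and homotopies are piecewise smooth. $\gamma^{-1}(t)=\gamma(1-t)$. **Representations up to homotopy of $\pi_\infty(M)$.** $\pi_\infty(M)$ is the simplicial set of simplices $\sigma:\Delta_k\to M$, with face maps $d_i=\partial_i^*$, where $\partial_i:\Delta_k\to\Delta_{k+1}$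 is $\partial_0(t_1,\dots,t_k)=(1,t_1,\dots,t_k)$, $\partial_i(t_1,\dots,t_k)=(t_1,\dots,t_i,t_i,\dots,t_k)$ for $0<i<k+1$, $\partial_{k+1}(t_1,\dots,t_k)=(t_1,\dots,t_k,0)$, and degeneracies $s_i$ induced by the standard maps omitting a coordinate. A representation up to homotopy of $\pi_\infty(M)$ on $(V,\partial)$ is a family $\beta=(\beta^n)_{n\ge1}$, $\beta^n$ assigning to each $n$-simplex $\sigma$ an element $\beta^n(\sigma)\in\mathrm{End}^{1-n}(V)$, such that for all $n\ge 1$ $$[\partial,\beta^n(\sigma)]=\sum_{j=1}^{n-1}(-1)^j\beta^{n-1}(d_j\sigma)+\sum_{j=1}^{n-1}(-1)^{j+1}(\beta^j\cup\beta^{n-j})(\sigma),$$ where $(\beta^i\cup\beta^j)(\sigma)=\beta^i(d_{i+1}\cdots d_{i+j}\sigma)\,\beta^j((d_0)^i\sigma)$ (front face, then back face), and such that $\beta^1(s_0x)=\mathrm{id}$ and $\beta^n(s_i\sigma)=0$ for $n>1$. An $n$-simplex is thin if it has rank $<n$; $\beta$ is well behaved if $\beta^2(\sigma)=0$ for every thin $2$-simplex $\sigma$. **The Lie crossed module $\mathsf{GL}(V)$.** A Lie crossed module is a Lie group homomorphism $\delta:E\to G$ with a left action $\rhd$ of $G$ on $E$ by Lie group automorphisms such that $\delta(g\rhd e)=g\,\delta(e)\,g^{-1}$ and $\delta(e)\rhd f=efe^{-1}$. $\mathsf{GL}(V)=(\delta:\mathsf{GL}^{-1}(V)\to\mathsf{GL}^0(V))$: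 $\mathsf{GL}^0(V)$ is the group of automorphisms of the complex $(V,\partial)$; $\mathsf{GL}^{-1}(V)=\mathrm{End}^{-1}(V)'/[\partial,\mathrm{End}^{-2}(V)]$, where $\mathrm{End}^{-1}(V)'=\{s\in\mathrm{End}^{-1}(V):[\partial,s]+\mathrm{id}\text{ invertible}\}$ with product $s*t=s+t+s[\partial,t]$ (unit $0$); $\delta(s)=[\partial,s]+\mathrm{id}$; $\phi\rhd s=\phi s\phi^{-1}$. **Representations of the fundamental 2-groupoid.** A $2$-path is a piecewise smooth $\Gamma:I^2\to M$ constant on each of the two vertical sides; $\Gamma_s(t)=\Gamma(t,s)$. A representation of the fundamental $2$-groupoid of $M$ in a Lie crossed module $\delta:E\to G$ assigns to every path $\gamma:I\to M$ an element $\mathsf{Hol}(\gamma)\in G$ and to every $2$-path $\Gamma$ an element $\mathsf{Hol}(\Gamma)\in E$ such that: (1) $\mathsf{Hol}(\gamma)=1$ for constant paths; (2) $\mathsf{Hol}(\Gamma)=1$ for constant $2$-paths; (3) $\mathsf{Hol}(\Gamma)=\mathsf{Hol}(\Gamma')$ if $\Gamma,\Gamma'$ are homotopic relative to the boundary; (4) $\delta(\mathsf{Hol}(\Gamma))=\mathsf{Hol}(\Gamma_0)^{-1}\mathsf{Hol}(\Gamma_1)$; (5) compositions are preserved: $\mathsf{Hol}(\gamma\text{ then }\gamma')=\mathsf{Hol}(\gamma')\mathsf{Hol}(\gamma)$; stacking $\Gamma'$ on top of $\Gamma$ (when $\Gamma_1=\Gamma'_0$) gives $\mathsf{Hol}(\Gamma)\mathsf{Hol}(\Gamma')$;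 placing $\Gamma'$ to the right of $\Gamma$ (when the right side of $\Gamma$ and the left side of $\Gamma'$ agree) gives $(\mathsf{Hol}(\Gamma_0)^{-1}\rhd\mathsf{Hol}(\Gamma'))\,\mathsf{Hol}(\Gamma)$. **Notation.** $\Gamma_a=\Gamma\circ a$ and $\Gamma_b=\Gamma\circ b$, where $a,b:\Delta_2=\{1\ge t\ge s\ge0\}\to I^2$, $a(t,s)=(s,t)$, $b(t,s)=(t,s)$. *)

(* Defs.v *)
From HB Require Import structures.
From mathcomp Require Import all_boot all_order all_algebra.
From mathcomp Require Import all_classical all_reals all_analysis.
From mathcomp Require Import ring lra ssrAC generic_quotient.

Set Implicit Arguments.
Unset Strict Implicit.
Unset Printing Implicit Defensive.

Import Order.TTheory GRing.Theory Num.Theory.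
Import numFieldNormedType.Exports.

Local Open Scope classical_set_scope.
Local Open Scope ring_scope.

Section Smooth.
Variable R : realType.

Fixpoint Ck_on (k n m : nat) (W : set 'rV[R]_n) (f : 'rV[R]_n -> 'rV[R]_m)
    : Prop :=
  if k is k'.+1 then
    (forall x, W x -> differentiable f x) /\ forall v, Ck_on k' W ('D_v f)
  else forall x, W x -> {for x, continuous f}.

(* Only meaningful when [W] is open. *)
Definition smooth_on n m (W : set 'rV[R]_n) (f : 'rV[R]_n -> 'rV[R]_m) :=
  forall k, Ck_on k W f.

Record chart (n : nat) (M : topologicalType) := Chart {
  chart_dom : set M;
  chart_img : set 'rV[R]_n;
  chart_map : M -> 'rV[R]_n;
  chart_inv : 'rV[R]_n -> M;
  chart_dom_open : open chart_dom;
  chart_img_open : open chart_img;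
  chart_mapK : forall p, chart_dom p ->
    chart_img (chart_map p) /\ chart_inv (chart_map p) = p;
  chart_invK : forall x, chart_img x ->
    chart_dom (chart_inv x) /\ chart_map (chart_inv x) = x;
  chart_map_cont : forall p, chart_dom p -> {for p, continuous chart_map};
  chart_inv_cont : forall x, chart_img x -> {for x, continuous chart_inv} }.

(* The atlas is not required to be maximal: any smooth atlas determines the
   smooth structure. *)
Record smooth_manifold := SmoothManifold {
  mfd_space :> topologicalType;
  mfd_hausdorff : hausdorff_space mfd_space;
  mfd_second_countable : @second_countable mfd_space;
  mfd_dim : nat;
  mfd_atlas : set (chart mfd_dim mfd_space);
  mfd_cover : forall p : mfd_space, exists2 c, mfd_atlas c & chart_dom c p;
  mfd_compat : forall c c', mfd_atlas c -> mfd_atlas c' ->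
    smooth_on (chart_img c `&` chart_inv c @^-1` chart_dom c')
              (chart_map c' \o chart_inv c) }.

Definition polyhedron n (P : set 'rV[R]_n) :=
  exists (N : nat) (A : 'M[R]_(n, N)) (b : 'rV[R]_N),
    P = [set x | forall j, (x *m A) 0 j <= b 0 j].

Definition affine n m (a : 'rV[R]_n -> 'rV[R]_m) :=
  forall (x y : 'rV[R]_n) (c : R),
    a (c *: x + (1 - c) *: y) = c *: a x + (1 - c) *: a y.

Section Maps.
Variable M : smooth_manifold.

(* On [P], the map [f] is locally, in charts of [M], the restriction of a
   smooth map defined on an open subset of R^n. *)
Definition smooth_on_piece n (D : set 'rV[R]_n) (f : D -> M) (P : set 'rV[R]_n) :=
  forall x : D, P (val x) ->
  exists (c : chart (mfd_dim M) M) (W : set 'rV[R]_n) g,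
    [/\ mfd_atlas c, open W, W (val x), smooth_on W g &
        forall y : D, W (val y) -> P (val y) ->
          chart_dom c (f y) /\ chart_map c (f y) = g (val y)].

(* Smooth on each closed piece of a finite polyhedral cover of the domain;
   continuity follows, by pasting along finitely many closed sets. *)
Definition piecewise_smooth n (D : set 'rV[R]_n) (f : D -> M) :=
  exists (I : finType) (P : I -> set 'rV[R]_n),
    [/\ forall i, polyhedron (P i),
        forall x : D, exists i, P i (val x) &
        forall i, smooth_on_piece f (P i)].

Record pwmap n (D : set 'rV[R]_n) := PwMap {
  pw_fun :> D -> M;
  pw_smooth : piecewise_smooth pw_fun }.

(* The rank is tested at the interior points near which the map is smooth. *)
Definition thin n (D : set 'rV[R]_n) (f : pwmap D) :=
  forall (x : D) (c : chart (mfd_dim M) M) (W : set 'rV[R]_n) g,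
    mfd_atlas c -> open W -> W (val x) -> W `<=` D -> smooth_on W g ->
    (forall y : D, W (val y) ->
      chart_dom c (f y) /\ chart_map c (f y) = g (val y)) ->
    (\rank (jacobian g (val x)) < n)%N.

End Maps.

Record affmap n m (D : set 'rV[R]_n) (D' : set 'rV[R]_m) := AffMap {
  aff_fun :> 'rV[R]_n -> 'rV[R]_m;
  aff_affine : affine aff_fun;
  aff_maps : forall x, D x -> D' (aff_fun x) }.

Definition aff_on n m (D : set 'rV[R]_n) (D' : set 'rV[R]_m)
  (a : affmap D D') (x : D) : D' :=
  SigSub (mem_set (aff_maps a (set_mem (valP x)))).

Lemma affine_mx n m (a : 'rV[R]_n -> 'rV[R]_m) : affine a ->
  exists (A : 'M[R]_(n, m)) (b : 'rV[R]_m), a = fun x => x *m A + b.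
Proof.
move=> aff; pose g x := a x - a 0.
have gZ c x : g (c *: x) = c *: g x.
  have := aff x 0 c; rewrite scaler0 addr0 /g => ->.
  by rewrite scalerBr scalerBl scale1r addrA addrAC addrK.
have gD x y : g (x + y) = g x + g y.
  have h : 2^-1 + 2^-1 = 1 :> R by field.
  have h' : 1 - 2^-1 = 2^-1 :> R by rewrite -{1}h addrK.
  have e : x + y = 2 *: (2^-1 *: x + 2^-1 *: y).
    by rewrite scalerDr !scalerA divff ?pnatr_eq0// !scale1r.
  rewrite {1}e gZ; have := aff x y 2^-1; rewrite h' {1}/g => ->.
  have -> : a 0 = 2^-1 *: a 0 + 2^-1 *: a 0 by rewrite -scalerDl h scale1r.
  rewrite opprD addrACA -!scalerBr scalerDr !scalerA divff ?pnatr_eq0//.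
  by rewrite !scale1r.
exists (\matrix_(i < n) g (delta_mx 0 i)), (a 0); apply/funext => x.
rewrite mulmx_sum_row; apply/eqP; rewrite -subr_eq -/(g x); apply/eqP.
rewrite [in LHS](row_sum_delta x).
have g0 : g 0 = 0 by rewrite /g subrr.
rewrite (big_morph g gD g0); apply: eq_bigr => i _.
by rewrite gZ rowK.
Qed.

Lemma mulmx_row_continuous n m (A : 'M[R]_(n, m)) :
  continuous (fun x : 'rV[R]_n => x *m A).
Proof.
have -> : (fun x : 'rV[R]_n => x *m A) =
    (fun x : 'rV[R]_n => \sum_i x 0 i *: row i A).
  by apply/funext => x; rewrite mulmx_sum_row.
elim: (index_enum _) => [|i r IH] x.
  rewrite (_ : (fun _ => _) = fun=> 0); first exact: cst_continuous.
  by apply/funext => y; rewrite big_nil.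
rewrite (_ : (fun _ => _) = fun y : 'rV[R]_n =>
  y 0 i *: row i A + \sum_(j <- r) y 0 j *: row j A); last first.
  by apply/funext => y; rewrite big_cons.
exact: (cvgD (cvgZ (@coord_continuous R 1 n 0 i x) (cvg_cst _)) (IH x)).
Qed.

Lemma affine_differentiable n m (A : 'M[R]_(n, m)) (b : 'rV[R]_m) x :
  differentiable (fun x : 'rV[R]_n => x *m A + b) x.
Proof.
apply: differentiableD; last exact: differentiable_cst.
exact: (@linear_differentiable _ _ _ (mulmxr A)) (@mulmx_row_continuous _ _ A).
Qed.

Lemma Ck_on_affine k n m p (A : 'M[R]_(n, m)) (b : 'rV[R]_m)
    (W : set 'rV[R]_m) (f : 'rV[R]_m -> 'rV[R]_p) :
  Ck_on k W f ->
  Ck_on k ((fun x => x *m A + b) @^-1` W) (f \o fun x => x *m A + b).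
Proof.
elim: k f => [|k IH] f /= => [cf x Wx|[df Cf]].
  apply: continuous_comp; last exact: cf.
  exact/differentiable_continuous/affine_differentiable.
split=> [x Wx|v].
  apply: differentiable_comp; first exact: affine_differentiable.
  exact: df.
have -> : 'D_v (f \o fun x => x *m A + b) =
  'D_(v *m A) f \o fun x => x *m A + b.
  apply/funext => x /=; rewrite /derive; do 2 f_equal.
  apply/funext => h /=; congr (_ *: (f _ - f _)).
  by rewrite mulmxDl -scalemxAl addrA.
exact: IH.
Qed.

Lemma polyhedron_affine n m (a : 'rV[R]_n -> 'rV[R]_m) P :
  affine a -> polyhedron P -> polyhedron (a @^-1` P).
Proof.
move=> /affine_mx[A [b ->]] [N [B [c ->]]].
exists N, (A *m B), (c - b *m B); apply/seteqP.
have eL x j : ((x *m A + b) *m B) 0 j = (x *m (A *m B)) 0 j + (b *m B) 0 j.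
  by rewrite mulmxDl mulmxA [LHS]mxE.
have eR j : (c - b *m B) 0 j = c 0 j - (b *m B) 0 j.
  by rewrite [LHS]mxE [X in _ + X]mxE.
by split=> x /= h j; have := h j; rewrite eL eR lerBrDr.
Qed.

Lemma polyhedronI n (P Q : set 'rV[R]_n) :
  polyhedron P -> polyhedron Q -> polyhedron (P `&` Q).
Proof.
move=> [N [A [b ->]]] [N' [A' [b' ->]]].
exists (N + N')%N, (row_mx A A'), (row_mx b b').
apply/seteqP; split=> x /=.
  move=> [h h'] j; rewrite mul_mx_row.
  by case: (split_ordP j) => i ->; rewrite ?row_mxEl ?row_mxEr.
move=> h; split=> j.
  by have := h (lshift _ j); rewrite mul_mx_row !row_mxEl.
by have := h (rshift _ j); rewrite mul_mx_row !row_mxEr.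
Qed.

Lemma polyhedronT n : polyhedron [set: 'rV[R]_n].
Proof. by exists 0%N, 0, 0; apply/seteqP; split=> // x _ []. Qed.

Lemma piecewise_smooth_cover (M : smooth_manifold) n m (D : set 'rV[R]_n)
    (D' : set 'rV[R]_m) (f : D -> M) (J : finType) (Q : J -> set 'rV[R]_n)
    (a : J -> 'rV[R]_n -> 'rV[R]_m) (F : J -> D' -> M) :
  (forall j, polyhedron (Q j)) -> (forall x : D, exists j, Q j (val x)) ->
  (forall j, affine (a j)) ->
  (forall j (x : D), Q j (val x) ->
    exists2 y : D', val y = a j (val x) & f x = F j y) ->
  (forall j, piecewise_smooth (F j)) -> piecewise_smooth f.
Proof.
move=> pQ cQ aa fF; move=> /choice[I] /(_ _)/cid-/all_sig[P hP].
exists {j : J & I j}, (fun ji => Q (tag ji) `&` a (tag ji) @^-1` P _ (tagged ji)).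
split.
- move=> [j i] /=; apply: polyhedronI => //; apply: polyhedron_affine => //.
  by have [+ _ _] := hP j; apply.
- move=> x; have [j Qj] := cQ x; have [y yE _] := fF j x Qj.
  have [_ /(_ y)[i Pi] _] := hP j; exists (Tagged (fun j => I j) i); split => //=.
  by rewrite -yE.
- move=> [j i] x /= [Qx Px]; have [y yE fy] := fF j x Qx.
  have [_ _ /(_ i y)] := hP j; rewrite yE => /(_ Px).
  move=> [c [W [g [ac oW Wy sg H]]]].
  have [A [b aE]] := affine_mx (aa j).
  exists c, (a j @^-1` W), (g \o a j); split => //.
  + apply: open_comp => // z _; rewrite aE.
    exact/differentiable_continuous/affine_differentiable.
  + by move=> k; rewrite aE; apply: Ck_on_affine; exact: sg.
  + move=> z Wz [Qz Pz]; have [w wE ->] := fF j z Qz.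
    by have := H w; rewrite wE /=; apply.
Qed.

Section Pull.
Variables (M : smooth_manifold).

Lemma pull_subproof n m (D : set 'rV[R]_n) (D' : set 'rV[R]_m)
  (a : affmap D D') (f : pwmap M D') : piecewise_smooth (f \o aff_on a).
Proof.
apply: (@piecewise_smooth_cover M n m D D' _ unit (fun _ => setT)
  (fun _ => a) (fun _ => f)).
- by move=> _; exact: polyhedronT.
- by move=> x; exists tt.
- by move=> _; exact: aff_affine.
- by move=> _ x _; exists (aff_on a x).
- by move=> _; exact: pw_smooth.
Qed.

Definition pull n m (D : set 'rV[R]_n) (D' : set 'rV[R]_m)
  (a : affmap D D') (f : pwmap M D') : pwmap M D := PwMap (pull_subproof a f).

End Pull.

Section Simplices.

(* The convention t_0 = 1 and t_l = 0 for l > k. *)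
Definition simplex_coord k (t : 'rV[R]_k) (l : nat) : R :=
  if l is l'.+1 then oapp (fun j => t 0 j) 0 (insub l' : option 'I_k) else 1.

Definition std_simplex k : set 'rV[R]_k :=
  [set t | forall l, (l <= k)%N -> simplex_coord t l.+1 <= simplex_coord t l].

(* With coordinates numbered from 0, the entry of index l is t_{l+1}. *)
Definition face_map k (i : nat) (t : 'rV[R]_k) : 'rV[R]_k.+1 :=
  \row_l simplex_coord t (if (l < i)%N then l.+1 else l).

Definition degeneracy_map k (i : nat) (t : 'rV[R]_k.+1) : 'rV[R]_k :=
  \row_l simplex_coord t (if (l < i)%N then l.+1 else l.+2).

Lemma simplex_coordS k (t : 'rV[R]_k) (l : nat) (lk : (l < k)%N) :
  simplex_coord t l.+1 = t 0 (Ordinal lk).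
Proof. by rewrite /= insubT. Qed.

Lemma simplex_coord_out k (t : 'rV[R]_k) (l : nat) :
  (k < l)%N -> simplex_coord t l = 0.
Proof.
by case: l => // l; rewrite ltnS => kl; rewrite /= insubF// ltnNge kl.
Qed.

Lemma simplex_coord_row k (F : 'I_k -> R) (G : nat -> R) l :
  (forall j : 'I_k, F j = G j) -> (l < k)%N ->
  simplex_coord (\row_j F j) l.+1 = G l.
Proof. by move=> FG lk; rewrite simplex_coordS mxE FG. Qed.

Lemma simplex_coord_affine k (s t : 'rV[R]_k) (c : R) l :
  simplex_coord (c *: s + (1 - c) *: t) l =
  c * simplex_coord s l + (1 - c) * simplex_coord t l.
Proof.
case: l => [|l] /=; first by ring.
by case: insubP => [j _ _|_] /=; [rewrite !mxE|ring].
Qed.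

Lemma row_coord_affine k m (p : nat -> nat) :
  affine (fun t : 'rV[R]_k => \row_(l < m) simplex_coord t (p l)).
Proof. by move=> s t c; apply/rowP => l; rewrite !mxE simplex_coord_affine. Qed.

Lemma std_simplex_mono k (t : 'rV[R]_k) i j : std_simplex t -> (i <= j)%N ->
  simplex_coord t j <= simplex_coord t i.
Proof.
move=> ht; elim: j => [|j IH]; first by rewrite leqn0 => /eqP->.
rewrite leq_eqVlt => /predU1P[->//|]; rewrite ltnS => /IH.
apply: le_trans; have [jk|kj] := leqP j k; first exact: ht.
by rewrite !simplex_coord_out// (ltn_trans kj).
Qed.

Lemma std_simplex_ge0 k (t : 'rV[R]_k) l :
  std_simplex t -> 0 <= simplex_coord t l.
Proof.
move=> ht; rewrite -(@simplex_coord_out _ t (maxn k l).+1) ?ltnS ?leq_maxl//.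
by apply: std_simplex_mono => //; rewrite ltnW// ltnS leq_maxr.
Qed.

Lemma std_simplex_row k m (t : 'rV[R]_k) (p : nat -> nat) : std_simplex t ->
  {homo p : x y / (x <= y)%N} ->
  std_simplex (\row_(l < m) simplex_coord t (p l)).
Proof.
move=> ht hp l lm.
have coordE j (jm : (j < m)%N) : simplex_coord
    (\row_(l < m) simplex_coord t (p l)) j.+1 = simplex_coord t (p j).
  exact: (@simplex_coord_row _ _ (fun j => simplex_coord t (p j))).
have [lm'|ml] := ltnP l m; last first.
  rewrite (@simplex_coord_out _ _ l.+1)//.
  case: l {ml} lm => [|l] lm; first exact: ler01.
  by rewrite coordE// std_simplex_ge0.
rewrite coordE//; case: l lm' {lm} => [|l] lm.
  by apply: (@std_simplex_mono _ _ 0).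
rewrite (coordE l (ltnW lm)).
by apply: std_simplex_mono => //; apply: hp.
Qed.

Lemma face_map_simplex k i (t : 'rV[R]_k) :
  std_simplex t -> std_simplex (face_map i t).
Proof.
move=> ht; apply: (@std_simplex_row _ _ _ (fun l => if (l < i)%N then l.+1 else l)).
  by [].
move=> x y xy; case: ifP => xi; case: ifP => // yi.
  rewrite ltn_neqAle xy andbT; apply: contraFN yi => /eqP <-; exact: xi.
by rewrite ltnW.
Qed.

Lemma degeneracy_map_simplex k i (t : 'rV[R]_k.+1) :
  std_simplex t -> std_simplex (degeneracy_map i t).
Proof.
move=> ht; apply: (@std_simplex_row _ _ _ (fun l => if (l < i)%N then l.+1 else l.+2)).
  by [].
move=> x y xy; case: ifP => xi; case: ifP => // yi; rewrite ?ltnS//.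
  exact: ltnW.
by have := leq_ltn_trans xy yi; rewrite xi.
Qed.

Lemma face_map_affine k i : affine (@face_map k i).
Proof. exact: (@row_coord_affine _ _ (fun l => if (l < i)%N then l.+1 else l)). Qed.

Lemma degeneracy_map_affine k i : affine (@degeneracy_map k i).
Proof.
exact: (@row_coord_affine _ _ (fun l => if (l < i)%N then l.+1 else l.+2)).
Qed.

Definition face_aff k i : affmap (@std_simplex k) (@std_simplex k.+1) :=
  AffMap (@face_map_affine k i) (@face_map_simplex k i).

Definition degeneracy_aff k i : affmap (@std_simplex k.+1) (@std_simplex k) :=
  AffMap (@degeneracy_map_affine k i) (@degeneracy_map_simplex k i).

Definition simplex (M : smooth_manifold) (k : nat) := pwmap M (@std_simplex k).

Variable M : smooth_manifold.

(* For i > k + 1 this is again the last face; only i <= k + 1 is used. *)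
Definition face k (i : nat) (sigma : simplex M k.+1) : simplex M k :=
  pull (face_aff k i) sigma.

Definition degeneracy k (i : nat) (sigma : simplex M k) : simplex M k.+1 :=
  pull (degeneracy_aff k i) sigma.

Definition cast_simplex k l (e : k = l) (sigma : simplex M k) : simplex M l :=
  ecast n (simplex M n) e sigma.

(* d_{i+1} ... d_{i+j}, the innermost operator being d_{i+j} *)
Fixpoint front_face (j i : nat) : simplex M (j + i) -> simplex M i :=
  if j is j'.+1 then fun sigma => front_face (face (j'.+1 + i) sigma)
  else fun sigma => sigma.

Fixpoint back_face (i j : nat) : simplex M (i + j) -> simplex M j :=
  if i is i'.+1 then fun sigma => back_face (face 0 sigma)
  else fun sigma => sigma.

End Simplices.

Section Cubes.

Definition cube n : set 'rV[R]_n := [set x | forall i, 0 <= x 0 i <= 1].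

Variable M : smooth_manifold.

Definition path1 := pwmap M (@cube 1).

Definition on_side n (i : 'I_n) (c : R) (x : @cube n) := (val x) 0 i = c.

Definition agree_off n (i : 'I_n) (x y : @cube n) :=
  forall j, j != i -> (val x) 0 j = (val y) 0 j.

(* The face [x_i = 1] of [f] is the face [x_i = 0] of [g]. *)
Definition composable n (i : 'I_n) (f g : pwmap M (@cube n)) :=
  forall x y : @cube n,
    on_side i 1 x -> on_side i 0 y -> agree_off i x y -> f x = g y.

(* Rescaling by 2 of the i-th coordinate, translated by -c *)
Definition double_coord n (i : 'I_n) (c : R) (x : 'rV[R]_n) : 'rV[R]_n :=
  \row_j (if j == i then 2 * x 0 j - c else x 0 j).

(* [f] on [x_i <= 1/2] followed by [g] on [x_i >= 1/2]; the default value of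
   [insubd] is never used, see [concat_lo] and [concat_hi]. *)
Definition concat_fun n (i : 'I_n) (f g : pwmap M (@cube n)) (x : @cube n) : M :=
  if (val x) 0 i <= 2^-1 then f (insubd x (double_coord i 0 (val x)))
  else g (insubd x (double_coord i 1 (val x))).

Lemma double_affine n (i : 'I_n) c : affine (double_coord i c).
Proof.
move=> x y a; apply/rowP => j; rewrite !mxE; case: ifP => // _.
by ring.
Qed.

Lemma concat_lo n (i : 'I_n) (x : @cube n) : (val x) 0 i <= 2^-1 ->
  val (insubd x (double_coord i 0 (val x)) : @cube n) = double_coord i 0 (val x).
Proof.
move=> hx; rewrite insubdK// inE => j; rewrite mxE.
have /(_ j) := set_mem (valP x); case: eqP => // ->; lra.
Qed.

Lemma concat_hi n (i : 'I_n) (x : @cube n) : 2^-1 <= (val x) 0 i ->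
  val (insubd x (double_coord i 1 (val x)) : @cube n) = double_coord i 1 (val x).
Proof.
move=> hx; rewrite insubdK// inE => j; rewrite mxE.
have /(_ j) := set_mem (valP x); case: eqP => // ->; lra.
Qed.

Lemma polyhedron_coord n (i : 'I_n) (a b : R) :
  polyhedron [set x : 'rV[R]_n | a * x 0 i <= b].
Proof.
exists 1, (a *: delta_mx i 0), (const_mx b).
have E (x : 'rV[R]_n) : (x *m (a *: delta_mx i 0 : 'cV_n)) 0 0 = a * x 0 i.
  rewrite -scalemxAr mxE; congr (_ * _).
  rewrite mxE (bigD1 i)//= mxE !eqxx mulr1 big1 ?addr0// => j /negPf ji.
  by rewrite mxE ji mulr0.
by apply/seteqP; split=> x /= h; [move=> j|have := h 0];
  rewrite ?(ord1 j) E mxE.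
Qed.

Lemma concat_subproof n (i : 'I_n) (f g : pwmap M (@cube n)) :
  composable i f g -> piecewise_smooth (concat_fun i f g).
Proof.
move=> fg; apply: (@piecewise_smooth_cover M n n (@cube n) (@cube n) _ bool
  (fun b => if b then [set x : 'rV[R]_n | 1 * x 0 i <= 2^-1]
            else [set x : 'rV[R]_n | -1 * x 0 i <= - 2^-1])
  (fun b => if b then double_coord i 0 else double_coord i 1)
  (fun b => if b then f else g)).
- by case; exact: polyhedron_coord.
- move=> x; have [h|h] := lerP ((val x) 0 i) 2^-1.
    by exists true => /=; rewrite mul1r.
  by exists false => /=; rewrite mulN1r lerN2 ltW.
- by case; exact: double_affine.
- case=> x /=; rewrite ?mul1r ?mulN1r ?lerN2 => h.
    exists (insubd x (double_coord i 0 (val x))); first exact: concat_lo.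
    by rewrite /concat_fun h.
  exists (insubd x (double_coord i 1 (val x))); first exact: concat_hi.
  rewrite /concat_fun; case: ifPn => // h'.
  have xi : (val x) 0 i = 2^-1 by apply/eqP; rewrite eq_le h h'.
  apply: fg; rewrite /on_side /agree_off ?(concat_lo h') ?(concat_hi h).
  + by rewrite mxE eqxx xi; field.
  + by rewrite mxE eqxx xi; field.
  + by move=> j /negPf ji; rewrite !mxE ji.
- by case; exact: pw_smooth.
Qed.

Definition concat n (i : 'I_n) (f g : pwmap M (@cube n)) (e : composable i f g) :
  pwmap M (@cube n) := PwMap (concat_subproof e).

End Cubes.

End Smooth.

Record cochain_complex (R : realType) := CochainComplex {
  cc_space :> vectType R;
  cc_gr : int -> {vspace cc_space};
  cc_direct : forall s : seq int, uniq s -> directv (\sum_(i <- s) cc_gr i);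
  cc_total : exists s : seq int, (\sum_(i <- s) cc_gr i)%VS = fullv;
  cc_d : 'End(cc_space);
  cc_d_deg : forall i, (cc_d @: cc_gr i <= cc_gr (i + 1))%VS;
  cc_dd : (cc_d \o cc_d)%VF = 0 }.

(* The group-theoretic data only: the smooth structures of a Lie crossed module
   do not occur in the axioms of a representation of the 2-groupoid. *)
Record crossed_module := CrossedModule {
  cm_E : groupType;
  cm_G : groupType;
  cm_delta : cm_E -> cm_G;
  cm_act : cm_G -> cm_E -> cm_E;
  cm_deltaM : forall e f, (cm_delta (e * f) = cm_delta e * cm_delta f)%g;
  cm_act1 : forall e, cm_act 1%g e = e;
  cm_actM : forall g h e, cm_act (g * h)%g e = cm_act g (cm_act h e);
  cm_act_mul : forall g e f, (cm_act g (e * f) = cm_act g e * cm_act g f)%g;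
  cm_equivariant : forall g e,
    (cm_delta (cm_act g e) = g * cm_delta e * g^-1)%g;
  cm_peiffer : forall e f, (cm_act (cm_delta e) f = e * f * e^-1)%g }.

Section GL.
Variables (R : realType) (V : cochain_complex R).
Implicit Types (f g s t : 'End(V)).

(* f lies in End^k(V) *)
Definition has_degree (k : int) f :=
  forall i, (f @: cc_gr V i <= cc_gr V (i + k))%VS.

(* [d, f] for f of degree k *)
Definition bracket (k : int) f : 'End(V) :=
  (cc_d V \o f)%VF - (-1) ^+ `|k|%N *: (f \o cc_d V)%VF.

Definition invertible f :=
  exists g, (g \o f)%VF = \1%VF /\ (f \o g)%VF = \1%VF.

Lemma invertibleP f : invertible f <-> lker f == 0%VS.
Proof.
split=> [[g [gf _]]|h].
  apply/lker0P => x y fxy.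
  by rewrite -[x](@id_lfunE _ V) -[y](@id_lfunE _ V) -gf !comp_lfunE fxy.
by exists (f^-1)%VF; rewrite lker0_compVf// lker0_compfV.
Qed.

Lemma has_degreeP k f :
  has_degree k f <-> forall i v, v \in cc_gr V i -> f v \in cc_gr V (i + k).
Proof.
split=> h i; first by move=> v vi; apply: (subvP (h i)); exact: memv_img.
by apply/subvP => _ /memv_imgP[v vi ->]; exact: h.
Qed.

Lemma has_degree_comp k l f g :
  has_degree k f -> has_degree l g -> has_degree (l + k) (f \o g)%VF.
Proof.
rewrite !has_degreeP => hf hg i v vi; rewrite comp_lfunE addrA.
by apply: hf; exact: hg.
Qed.

Lemma has_degreeD k f g : has_degree k f -> has_degree k g ->
  has_degree k (f + g).
Proof.
rewrite !has_degreeP => hf hg i v vi; rewrite add_lfunE.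
by apply: memvD; [exact: hf|exact: hg].
Qed.

Lemma has_degreeZ k c f : has_degree k f -> has_degree k (c *: f).
Proof.
by rewrite !has_degreeP => hf i v vi; rewrite scale_lfunE memvZ// hf.
Qed.

Lemma has_degreeN k f : has_degree k f -> has_degree k (- f).
Proof. by rewrite -scaleN1r; exact: has_degreeZ. Qed.

Lemma has_degree0 k : has_degree k 0.
Proof. by rewrite has_degreeP => i v _; rewrite zero_lfunE mem0v. Qed.

Lemma has_degree1 : has_degree 0 \1%VF.
Proof. by rewrite has_degreeP => i v; rewrite id_lfunE addr0. Qed.

Lemma has_degreeV f : has_degree 0 f -> invertible f -> has_degree 0 (f^-1)%VF.
Proof.
move=> df /invertibleP f0 i.
have : (f @: cc_gr V i == cc_gr V i)%VS.
  rewrite eqEdim; move: (df i); rewrite addr0 => -> /=.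
  by rewrite limg_dim_eq// (eqP f0) capv0.
move=> /eqP {1}<-; rewrite -limg_comp lker0_compVf// addr0.
by rewrite lim1g.
Qed.

Lemma cc_d_degree : has_degree 1 (cc_d V).
Proof. exact: cc_d_deg. Qed.

Lemma bracketN1 s : bracket (-1) s = (cc_d V \o s)%VF + (s \o cc_d V)%VF.
Proof. by rewrite /bracket expr1 scaleN1r opprK. Qed.

Lemma bracketN2 s : bracket (- 2) s = (cc_d V \o s)%VF - (s \o cc_d V)%VF.
Proof. rewrite /bracket. have -> : (-1) ^+ `|(- 2)%R|%N = 1 :> R by rewrite sqrrN expr1n. by rewrite scale1r. Qed.

Definition gl0_pred : pred 'End(V) := fun f =>
  `[< [/\ has_degree 0 f, (cc_d V \o f)%VF = (f \o cc_d V)%VF & invertible f] >].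

Record gl0 := Gl0 { gl0_val :> 'End(V); gl0P : gl0_pred gl0_val }.
HB.instance Definition _ := [isSub for gl0_val].
HB.instance Definition _ := [Choice of gl0 by <:].

Lemma gl0_deg (f : gl0) : has_degree 0 f.
Proof. by have /asboolP[] := gl0P f. Qed.
Lemma gl0_comm (f : gl0) : (cc_d V \o f)%VF = (f \o cc_d V)%VF.
Proof. by have /asboolP[] := gl0P f. Qed.
Lemma gl0_inv (f : gl0) : invertible f.
Proof. by have /asboolP[] := gl0P f. Qed.
Lemma gl0_ker (f : gl0) : lker f == 0%VS.
Proof. by have /invertibleP := gl0_inv f. Qed.

Lemma gl0_one_subproof : gl0_pred \1%VF.
Proof.
apply/asboolP; split; first exact: has_degree1.
  by rewrite comp_lfun1l comp_lfun1r.
by exists \1%VF; rewrite comp_lfun1l.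
Qed.
Definition gl0_one := Gl0 gl0_one_subproof.

Lemma gl0_mul_subproof (f g : gl0) : gl0_pred (f \o g)%VF.
Proof.
apply/asboolP; split.
- by have := has_degree_comp (gl0_deg f) (gl0_deg g); rewrite addr0.
- by rewrite comp_lfunA gl0_comm -comp_lfunA gl0_comm comp_lfunA.
- have [f' [f'f ff']] := gl0_inv f; have [g' [g'g gg']] := gl0_inv g.
  exists (g' \o f')%VF; split.
    by rewrite -comp_lfunA (comp_lfunA f') f'f comp_lfun1l.
  by rewrite -comp_lfunA (comp_lfunA g) gg' comp_lfun1l.
Qed.
Definition gl0_mul (f g : gl0) := Gl0 (gl0_mul_subproof f g).

Lemma gl0_inv_subproof (f : gl0) : gl0_pred (f^-1)%VF.
Proof.
have fV := lker0_compVf (gl0_ker f); have Vf := lker0_compfV (gl0_ker f).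
apply/asboolP; split; first exact: has_degreeV (gl0_deg f) (gl0_inv f).
  rewrite -[LHS]comp_lfun1l -fV -comp_lfunA (comp_lfunA f) -gl0_comm.
  by rewrite -comp_lfunA Vf comp_lfun1r.
by exists f.
Qed.
Definition gl0_invg (f : gl0) := Gl0 (gl0_inv_subproof f).

Lemma gl0_mulA : associative gl0_mul.
Proof. by move=> f g h; apply/val_inj; rewrite /= comp_lfunA. Qed.
Lemma gl0_mul1 : left_id gl0_one gl0_mul.
Proof. by move=> f; apply/val_inj; rewrite /= comp_lfun1l. Qed.
Lemma gl0_1mul : right_id gl0_one gl0_mul.
Proof. by move=> f; apply/val_inj; rewrite /= comp_lfun1r. Qed.
Lemma gl0_mulV : left_inverse gl0_one gl0_invg gl0_mul.
Proof. by move=> f; apply/val_inj; rewrite /= lker0_compVf// gl0_ker. Qed.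
Lemma gl0_Vmul : right_inverse gl0_one gl0_invg gl0_mul.
Proof. by move=> f; apply/val_inj; rewrite /= lker0_compfV// gl0_ker. Qed.

HB.instance Definition _ :=
  isGroup.Build gl0 gl0_mulA gl0_mul1 gl0_1mul gl0_mulV gl0_Vmul.

Definition glm1_pred : pred 'End(V) := fun s =>
  `[< has_degree (-1) s /\ invertible (bracket (-1) s + \1%VF) >].

(* End^{-1}(V)', before passing to the quotient by [d, End^{-2}(V)]. *)
Record glm1' := Glm1' { glm1_val :> 'End(V); glm1P : glm1_pred glm1_val }.
HB.instance Definition _ := [isSub for glm1_val].
HB.instance Definition _ := [Choice of glm1' by <:].

Lemma glm1_deg (s : glm1') : has_degree (-1) s.
Proof. by have /asboolP[] := glm1P s. Qed.
Lemma glm1_inv (s : glm1') : invertible (bracket (-1) s + \1%VF).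
Proof. by have /asboolP[] := glm1P s. Qed.

Lemma glm1_delta_subproof (s : glm1') : gl0_pred (bracket (-1) s + \1%VF).
Proof.
apply/asboolP; split; last exact: glm1_inv.
  apply: has_degreeD has_degree1; rewrite bracketN1; apply: has_degreeD.
    by have := has_degree_comp cc_d_degree (glm1_deg s).
  by have := has_degree_comp (glm1_deg s) cc_d_degree.
rewrite bracketN1 !(comp_lfunDl, comp_lfunDr) comp_lfun1l comp_lfun1r.
rewrite -!comp_lfunA cc_dd comp_lfun0r addr0 !comp_lfunA cc_dd comp_lfun0l.
by rewrite add0r.
Qed.
Definition glm1_delta (s : glm1') := Gl0 (glm1_delta_subproof s).

Lemma bracket_bracket s : bracket (-1) (bracket (- 2) s) = 0.
Proof.
rewrite bracketN1 bracketN2 !(comp_lfunDl, comp_lfunDr, comp_lfunNl, comp_lfunNr).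
rewrite -!comp_lfunA cc_dd comp_lfun0r !comp_lfunA cc_dd comp_lfun0l.
by rewrite add0r oppr0 addr0 addNr.
Qed.

(* The product s * t of GL^{-1}(V); glm1_delta is s |-> [d, s] + id. *)
Definition glm1_op s t : 'End(V) := s + t + (s \o bracket (-1) t)%VF.

Lemma bracketM s t :
  bracket (-1) (glm1_op s t) + \1%VF =
  ((bracket (-1) s + \1) \o (bracket (-1) t + \1))%VF.
Proof.
have dC : (cc_d V \o bracket (-1) t = bracket (-1) t \o cc_d V)%VF.
  rewrite bracketN1 comp_lfunDl comp_lfunDr -!comp_lfunA cc_dd comp_lfun0r.
  by rewrite !comp_lfunA cc_dd comp_lfun0l add0r addr0.
have -> : bracket (-1) (glm1_op s t) = bracket (-1) s + bracket (-1) t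
    + (bracket (-1) s \o bracket (-1) t)%VF.
  rewrite [LHS]bracketN1 /glm1_op.
  move: (bracket (-1) s) (bracketN1 s) (bracket (-1) t) (bracketN1 t) dC.
  move=> bs bsE bt btE dC; rewrite [X in _ = _ + X + _]btE
    !(comp_lfunDl, comp_lfunDr).
  rewrite -(comp_lfunA s) -dC bsE comp_lfunDl !comp_lfunA.
  by rewrite [LHS]addrACA [X in X + _ = _]addrACA.
move: (bracket (-1) s) (bracket (-1) t) => bs bt.
rewrite !(comp_lfunDl, comp_lfunDr) !(comp_lfun1l, comp_lfun1r).
by rewrite addrA; congr (_ + _); rewrite [LHS]addrC addrA.
Qed.

Lemma glm1_one_subproof : glm1_pred 0.
Proof.
apply/asboolP; split; first exact: has_degree0.
rewrite bracketN1 comp_lfun0l comp_lfun0r !add0r.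
by have /asboolP[] := gl0_one_subproof.
Qed.
Definition glm1_one := Glm1' glm1_one_subproof.

Lemma glm1_mul_subproof (s t : glm1') : glm1_pred (glm1_op s t).
Proof.
apply/asboolP; split.
  apply: has_degreeD; first exact: has_degreeD (glm1_deg s) (glm1_deg t).
  have /= := has_degree_comp (glm1_deg s) (k := -1) (l := 0).
  apply; rewrite bracketN1; apply: has_degreeD.
    by have := has_degree_comp cc_d_degree (glm1_deg t).
  by have := has_degree_comp (glm1_deg t) cc_d_degree.
rewrite bracketM.
by have /asboolP[] := gl0_mul_subproof (glm1_delta s) (glm1_delta t).
Qed.
Definition glm1_mul (s t : glm1') : glm1' := Glm1' (glm1_mul_subproof s t).

Lemma glm1_deltaM (s t : glm1') :
  glm1_delta (glm1_mul s t) = (glm1_delta s * glm1_delta t)%g.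
Proof. by apply/val_inj; rewrite /= bracketM. Qed.

Lemma glm1_inv_opE (s : glm1') (d' := ((glm1_delta s)^-1)%VF)
    (u := - (s \o d')%VF) :
  [/\ bracket (-1) u + \1%VF = d', glm1_op s u = 0 & glm1_op u s = 0].
Proof.
have dd : ((glm1_delta s : 'End(V)) \o d')%VF = \1%VF.
  by rewrite lker0_compfV// gl0_ker.
have d'd : (d' \o (glm1_delta s : 'End(V)))%VF = \1%VF.
  by rewrite lker0_compVf// gl0_ker.
have us : glm1_op u s = 0.
  rewrite /glm1_op; have -> : bracket (-1) s = (glm1_delta s : 'End(V)) - \1%VF.
    by rewrite /= addrK.
  rewrite comp_lfunDr comp_lfunNr comp_lfun1r addrC -addrA addKr.
  by rewrite /u comp_lfunNl -comp_lfunA d'd comp_lfun1r addNr.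
have ud : bracket (-1) u + \1%VF = d'.
  have dE : gl0_val (glm1_delta s) = bracket (-1) s + \1%VF by [].
  have -> : bracket (-1) u + \1%VF =
      ((bracket (-1) u + \1) \o (glm1_delta s \o d'))%VF.
    by rewrite dd comp_lfun1r.
  rewrite comp_lfunA dE -bracketM us bracketN1 comp_lfun0l comp_lfun0r !add0r.
  by rewrite comp_lfun1l.
split => //; rewrite /glm1_op.
have -> : bracket (-1) u = d' - \1%VF by rewrite -ud addrK.
rewrite comp_lfunDr comp_lfunNr comp_lfun1r /u.
by rewrite addrA subrK subrr.
Qed.

Lemma glm1_inv_subproof (s : glm1') :
  glm1_pred (- (s \o (glm1_delta s)^-1)%VF).
Proof.
have [ud _ _] := glm1_inv_opE s.
apply/asboolP; split; last first.
  by rewrite ud; exact: gl0_inv (gl0_invg (glm1_delta s)).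
apply: has_degreeN.
by have := has_degree_comp (glm1_deg s) (gl0_deg (gl0_invg (glm1_delta s))).
Qed.
Definition glm1_invg (s : glm1') : glm1' := Glm1' (glm1_inv_subproof s).

Lemma bracket_linear k : {morph bracket k : s t / s + t}.
Proof.
move=> s t; rewrite /bracket comp_lfunDl comp_lfunDr scalerDr opprD.
by rewrite addrACA.
Qed.

Lemma bracketB k s t : bracket k (s - t) = bracket k s - bracket k t.
Proof.
rewrite bracket_linear; congr (_ + _); rewrite /bracket comp_lfunNl comp_lfunNr.
by rewrite scalerN opprB opprK addrC.
Qed.

Lemma glm1_opA s t u : glm1_op s (glm1_op t u) = glm1_op (glm1_op s t) u.
Proof.
have -> : glm1_op s (glm1_op t u) =
    s + glm1_op t u + (s \o (bracket (-1) (glm1_op t u) + \1%VF - \1%VF))%VF.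
  by rewrite addrK.
rewrite bracketM /glm1_op.
move: (bracket (-1) t) (bracket (-1) u) => bt bu.
rewrite !(comp_lfunDl, comp_lfunDr, comp_lfunNr) !(comp_lfun1l, comp_lfun1r).
rewrite !comp_lfunA.
rewrite [X in _ + (X - s)]addrA addrK.
by rewrite [LHS](AC ((1*3)*3) ((((1*2)*6)*3)*((7*4)*5))).
Qed.

(* x lies in [d, End^{-2}(V)] *)
Definition exact_deg2 (x : 'End(V)) :=
  exists2 h, has_degree (- 2) h & x = bracket (- 2) h.

Definition glm1_rel : rel glm1' := fun s t : glm1' =>
  `[< exact_deg2 (glm1_val s - glm1_val t) >].

Lemma glm1_rel_refl : reflexive glm1_rel.
Proof.
move=> s; apply/asboolP; exists 0; first exact: has_degree0.
by rewrite bracketN2 comp_lfun0l comp_lfun0r !subrr.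
Qed.

Lemma exact_deg2N x : exact_deg2 x -> exact_deg2 (- x).
Proof.
move=> [h dh ->]; exists (- h); first exact: has_degreeN.
by rewrite -[- h]sub0r bracketB [in RHS]bracketN2 comp_lfun0l comp_lfun0r
  subrr sub0r.
Qed.

Lemma exact_deg2D x y : exact_deg2 x -> exact_deg2 y -> exact_deg2 (x + y).
Proof.
move=> [h dh ->] [k dk ->]; exists (h + k); first exact: has_degreeD.
by rewrite bracket_linear.
Qed.

Lemma exact_deg2_compr x f : has_degree 0 f ->
  (cc_d V \o f)%VF = (f \o cc_d V)%VF ->
  exact_deg2 x -> exact_deg2 (x \o f)%VF.
Proof.
move=> df cf [h dh ->]; exists (h \o f)%VF.
  by have := has_degree_comp dh df; rewrite add0r.
rewrite !bracketN2 comp_lfunDl comp_lfunNl -!comp_lfunA cf.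
by [].
Qed.

Lemma exact_deg2_compl x f : has_degree 0 f ->
  (cc_d V \o f)%VF = (f \o cc_d V)%VF ->
  exact_deg2 x -> exact_deg2 (f \o x)%VF.
Proof.
move=> df cf [h dh ->]; exists (f \o h)%VF.
  by have := has_degree_comp df dh; rewrite addr0.
by rewrite !bracketN2 comp_lfunDr comp_lfunNr !comp_lfunA cf.
Qed.

Lemma glm1_rel_sym : symmetric glm1_rel.
Proof.
suff H (s t : glm1') : glm1_rel s t -> glm1_rel t s by move=> s t; apply/idP/idP; exact: H.
by move=> /asboolP/exact_deg2N; rewrite opprB => h; apply/asboolP.
Qed.

Lemma glm1_rel_trans : transitive glm1_rel.
Proof.
move=> t s u /asboolP h1 /asboolP h2; apply/asboolP.
by have := exact_deg2D h1 h2; rewrite addrA subrK.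
Qed.

Canonical glm1_equiv :=
  EquivRel glm1_rel glm1_rel_refl glm1_rel_sym glm1_rel_trans.

Definition glm1 := {eq_quot glm1_equiv}%qT.
HB.instance Definition _ := Choice.on glm1.
HB.instance Definition _ := EqQuotient.on glm1.

Definition glm1_class (s : glm1') : glm1 := (\pi s)%qT.

Lemma glm1_classP (s t : glm1') :
  glm1_class s = glm1_class t <-> exact_deg2 (glm1_val s - glm1_val t).
Proof.
by split=> [/eqmodP/asboolP|h]; last apply/eqmodP/asboolP.
Qed.

Lemma glm1_reprK (x : glm1) : glm1_class (repr x) = x.
Proof. exact: reprK. Qed.

Lemma glm1_repr (s : glm1') : exact_deg2 (glm1_val (repr (glm1_class s)) - glm1_val s).
Proof. by apply/glm1_classP; rewrite glm1_reprK. Qed.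

Lemma bracket_exact x : exact_deg2 x -> bracket (-1) x = 0.
Proof. by move=> [h _ ->]; exact: bracket_bracket. Qed.

Lemma glm1_delta_class (s t : glm1') :
  glm1_class s = glm1_class t -> glm1_delta s = glm1_delta t.
Proof.
move=> /glm1_classP/bracket_exact; rewrite bracketB => /eqP.
by rewrite subr_eq0 => /eqP e; apply/val_inj; rewrite /= e.
Qed.

Lemma glm1_mul_class (s s' t t' : glm1') :
  glm1_class s = glm1_class s' -> glm1_class t = glm1_class t' ->
  glm1_class (glm1_mul s t) = glm1_class (glm1_mul s' t').
Proof.
move=> es et.
have /(congr1 gl0_val)/= dt := glm1_delta_class et.
have bt : bracket (-1) t = bracket (-1) t'.
  by move/(congr1 (fun x => x - \1%VF)): dt; rewrite !addrK.
apply/glm1_classP; rewrite /= /glm1_op bt.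
have -> : glm1_val s + glm1_val t + (s \o bracket (-1) t')%VF -
    (glm1_val s' + glm1_val t' + (s' \o bracket (-1) t')%VF) =
    ((glm1_val s - glm1_val s') \o glm1_delta t')%VF + (glm1_val t - glm1_val t').
  rewrite /= comp_lfunDr comp_lfun1r comp_lfunDl comp_lfunNl !opprD.
  by rewrite [LHS](AC (3*3) (((3*6)*(1*4))*(2*5))).
apply: exact_deg2D; last exact/glm1_classP.
by apply: exact_deg2_compr;
  [exact: gl0_deg|exact: gl0_comm|exact/glm1_classP].
Qed.

Definition glm1q_one : glm1 := glm1_class glm1_one.
Definition glm1q_mul (x y : glm1) : glm1 := glm1_class (glm1_mul (repr x) (repr y)).
Definition glm1q_inv (x : glm1) : glm1 := glm1_class (glm1_invg (repr x)).

Lemma glm1q_mulE (s t : glm1') :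
  glm1q_mul (glm1_class s) (glm1_class t) = glm1_class (glm1_mul s t).
Proof. by apply: glm1_mul_class; rewrite glm1_reprK. Qed.

Lemma glm1q_mulA : associative glm1q_mul.
Proof.
move=> x y z; rewrite -[x]glm1_reprK -[y]glm1_reprK -[z]glm1_reprK !glm1q_mulE.
by congr glm1_class; apply/val_inj; rewrite /= glm1_opA.
Qed.

Lemma glm1q_mul1 : left_id glm1q_one glm1q_mul.
Proof.
move=> x; rewrite -[x]glm1_reprK glm1q_mulE; congr glm1_class.
by apply/val_inj; rewrite /= /glm1_op comp_lfun0l add0r addr0.
Qed.

Lemma glm1q_1mul : right_id glm1q_one glm1q_mul.
Proof.
move=> x; rewrite -[x]glm1_reprK glm1q_mulE; congr glm1_class.
apply/val_inj; rewrite /= /glm1_op bracketN1 comp_lfun0l comp_lfun0r !addr0.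
by rewrite comp_lfun0r addr0.
Qed.

Lemma glm1q_mulV : left_inverse glm1q_one glm1q_inv glm1q_mul.
Proof.
move=> x; rewrite -[X in glm1q_mul _ X]glm1_reprK glm1q_mulE; congr glm1_class.
by apply/val_inj => /=; have [_ _] := glm1_inv_opE (repr x).
Qed.

Lemma glm1q_Vmul : right_inverse glm1q_one glm1q_inv glm1q_mul.
Proof.
move=> x; rewrite -[X in glm1q_mul X _]glm1_reprK glm1q_mulE; congr glm1_class.
by apply/val_inj => /=; have [_ + _] := glm1_inv_opE (repr x).
Qed.

HB.instance Definition _ :=
  isGroup.Build glm1 glm1q_mulA glm1q_mul1 glm1q_1mul glm1q_mulV glm1q_Vmul.

Definition GL_delta (x : glm1) : gl0 := glm1_delta (repr x).

Lemma GL_deltaE (s : glm1') : GL_delta (glm1_class s) = glm1_delta s.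
Proof. by apply: glm1_delta_class; rewrite glm1_reprK. Qed.

Lemma bracket_conj (f : gl0) s :
  bracket (-1) ((f \o s) \o f^-1)%VF = ((f \o bracket (-1) s) \o f^-1)%VF.
Proof.
have cV := gl0_comm (gl0_invg f); rewrite /= in cV.
rewrite !bracketN1 comp_lfunDr comp_lfunDl !comp_lfunA gl0_comm.
by congr (_ + _); rewrite -!comp_lfunA cV.
Qed.

Lemma glm1_act_subproof (f : gl0) (s : glm1') :
  glm1_pred ((f \o s) \o f^-1)%VF.
Proof.
apply/asboolP; split.
  have h := has_degree_comp (gl0_deg f) (glm1_deg s).
  have := has_degree_comp h (gl0_deg (gl0_invg f)).
  by rewrite addr0 add0r.
rewrite bracket_conj.
have -> : ((f \o bracket (-1) s) \o f^-1)%VF + \1%VF =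
    gl0_val (f * glm1_delta s * f^-1)%g.
  rewrite /= comp_lfunDr comp_lfunDl comp_lfun1r.
  by rewrite lker0_compfV// gl0_ker.
exact: gl0_inv.
Qed.
Definition glm1_act (f : gl0) (s : glm1') : glm1' :=
  Glm1' (glm1_act_subproof f s).

Definition GL_act (f : gl0) (x : glm1) : glm1 := glm1_class (glm1_act f (repr x)).

Lemma GL_actE (f : gl0) (s : glm1') :
  GL_act f (glm1_class s) = glm1_class (glm1_act f s).
Proof.
apply/glm1_classP => /=.
rewrite -comp_lfunNl -comp_lfunDl -comp_lfunNr -comp_lfunDr.
apply: exact_deg2_compr.
- exact: (gl0_deg (gl0_invg f)).
- exact: (gl0_comm (gl0_invg f)).
apply: exact_deg2_compl; [exact: gl0_deg|exact: gl0_comm|].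
exact: glm1_repr.
Qed.

Lemma GL_deltaM (x y : glm1) : GL_delta (x * y)%g = (GL_delta x * GL_delta y)%g.
Proof.
rewrite -[x]glm1_reprK -[y]glm1_reprK.
by rewrite -[LHS]/(GL_delta (glm1q_mul _ _)) glm1q_mulE !GL_deltaE glm1_deltaM.
Qed.

Lemma GL_act1 (x : glm1) : GL_act 1%g x = x.
Proof.
rewrite -[x]glm1_reprK GL_actE; congr glm1_class; apply/val_inj => /=.
have -> : (\1^-1)%VF = \1%VF :> 'End(V).
  have h : lker (\1%VF : 'End(V)) == 0%VS := gl0_ker gl0_one.
  by rewrite -[LHS]comp_lfun1r lker0_compVf.
by rewrite comp_lfun1l comp_lfun1r.
Qed.

Lemma GL_actM (f g : gl0) (x : glm1) :
  GL_act (f * g)%g x = GL_act f (GL_act g x).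
Proof.
rewrite -[x]glm1_reprK !GL_actE; congr glm1_class; apply/val_inj => /=.
have := congr1 gl0_val (invgM f g) => /= ->.
by rewrite !comp_lfunA.
Qed.

Lemma GL_act_mul (f : gl0) (x y : glm1) :
  GL_act f (x * y)%g = (GL_act f x * GL_act f y)%g.
Proof.
rewrite -[x]glm1_reprK -[y]glm1_reprK.
rewrite -[(_ * _)%g]/(glm1q_mul _ _) glm1q_mulE !GL_actE.
rewrite -[RHS]/(glm1q_mul _ _) glm1q_mulE; congr glm1_class; apply/val_inj => /=.
rewrite /glm1_op bracket_conj !(comp_lfunDr, comp_lfunDl); congr (_ + _).
rewrite !comp_lfunA -(comp_lfunA (f \o repr x)%VF (f^-1)%VF f).
by rewrite lker0_compVf ?gl0_ker// comp_lfun1r.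
Qed.

Lemma GL_equivariant (f : gl0) (x : glm1) :
  GL_delta (GL_act f x) = (f * GL_delta x * f^-1)%g.
Proof.
rewrite -[x]glm1_reprK GL_actE !GL_deltaE; apply/val_inj => /=.
rewrite bracket_conj comp_lfunDr comp_lfunDl comp_lfun1r.
by rewrite lker0_compfV// gl0_ker.
Qed.

Lemma GL_peiffer (x y : glm1) : GL_act (GL_delta x) y = (x * y * x^-1)%g.
Proof.
apply: (mulIg x); rewrite -mulgA mulVg mulg1.
rewrite -[x]glm1_reprK -[y]glm1_reprK GL_deltaE GL_actE.
rewrite -[LHS]/(glm1q_mul _ _) -[RHS]/(glm1q_mul _ _) !glm1q_mulE.
move: (repr x) (repr y) => s t; apply/glm1_classP => /=.
set D := (_ + \1%VF); have Dker : lker D == 0%VS := gl0_ker (glm1_delta s).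
have -> : glm1_op ((D \o t) \o D^-1)%VF s = glm1_val s + (D \o t)%VF.
  rewrite /glm1_op (_ : bracket (-1) s = D - \1%VF); last by rewrite /D addrK.
  rewrite comp_lfunDr comp_lfunNr comp_lfun1r -(comp_lfunA (D \o t)%VF) lker0_compVf//.
  by rewrite comp_lfun1r addrC -addrA addKr addrC.
exists (s \o t)%VF; first by have := has_degree_comp (glm1_deg s) (glm1_deg t).
rewrite /glm1_op -[X in _ - X]addrA opprD addrACA subrr add0r /D comp_lfunDl comp_lfun1l.
rewrite opprD addrA addrK bracketN2 !bracketN1 comp_lfunDl comp_lfunDr opprD.
by rewrite !comp_lfunA addrA addrK.
Qed.

Definition GL : crossed_module :=
  CrossedModule GL_deltaM GL_act1 GL_actM GL_act_mul GL_equivariant GL_peiffer.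

End GL.

Section FundamentalTwoGroupoid.
Variable R : realType.

(* On I^2 the coordinate ord0 is t (horizontal), ord_max is s (vertical). *)
Definition point2 (x y : R) : 'rV[R]_2 := \row_j (if j == ord0 then x else y).

Lemma point2_affine n (i j : 'I_n) (a b a' b' : R) :
  affine (fun x : 'rV[R]_n => point2 (a * x 0 i + b) (a' * x 0 j + b')).
Proof.
by move=> x y c; apply/rowP => l; rewrite !mxE; case: ifP => _; ring.
Qed.

Lemma cube2P (x y : R) : 0 <= x <= 1 -> 0 <= y <= 1 -> cube (point2 x y).
Proof. by move=> hx hy i; rewrite mxE; case: ifP. Qed.

Lemma std_simplex1P (t : 'rV[R]_1) : std_simplex t -> cube t.
Proof.
move=> ht i; have := ht 0%N isT; have := ht 1%N isT.
rewrite (@simplex_coord_out _ _ _ 2)// !(@simplex_coordS R 1 t 0 isT) /=.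
by rewrite (_ : Ordinal _ = i) ?ord1// => -> ->.
Qed.

Lemma id_affine n : affine (fun x : 'rV[R]_n => x).
Proof. by []. Qed.

Definition simplex1_aff : affmap (@std_simplex R 1) (@cube R 1) :=
  AffMap (@id_affine 1) std_simplex1P.

Definition rev_map (x : 'rV[R]_1) : 'rV[R]_1 := \row_j (1 - x 0 j).

Lemma rev_affine : affine rev_map.
Proof. by move=> x y c; apply/rowP => j; rewrite !mxE; ring. Qed.

Lemma rev_cube x : cube x -> cube (rev_map x).
Proof. by move=> hx i; rewrite mxE; have := hx i; lra. Qed.

Definition rev_aff : affmap (@cube R 1) (@cube R 1) :=
  AffMap rev_affine rev_cube.

Definition slice_map (s : R) (x : 'rV[R]_1) : 'rV[R]_2 := point2 (x 0 0) s.

Lemma slice_affine s : affine (slice_map s).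
Proof.
rewrite (_ : slice_map s =
  fun x => point2 (1 * x 0 0 + 0) (0 * x 0 0 + s)); first exact: point2_affine.
by apply/funext => x; rewrite mul1r addr0 mul0r add0r.
Qed.

Lemma slice_cube s x : 0 <= s <= 1 -> cube x -> cube (slice_map s x).
Proof. by move=> hs hx; exact: cube2P. Qed.

Definition slice_aff s (hs : 0 <= s <= 1) : affmap (@cube R 1) (@cube R 2) :=
  AffMap (slice_affine s) (fun x => @slice_cube s x hs).

Lemma std_simplex2P (x : 'rV[R]_2) : std_simplex x ->
  0 <= x 0 ord0 <= 1 /\ 0 <= x 0 ord_max <= 1.
Proof.
move=> hx; have h0 := hx 0%N isT; have h1 := hx 1%N isT; have h2 := hx 2%N isT.
rewrite (@simplex_coord_out _ _ _ 3)// in h2.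
have e0 : simplex_coord x 1 = x 0 ord0.
  by rewrite (@simplex_coordS R 2 x 0 isT); congr (x 0 _); apply/val_inj.
have e1 : simplex_coord x 2 = x 0 ord_max.
  by rewrite (@simplex_coordS R 2 x 1 isT); congr (x 0 _); apply/val_inj.
rewrite e0 e1 [simplex_coord x 0]/= in h0 h1 h2; lra.
Qed.

(* a(t,s) = (s,t) and b(t,s) = (t,s) *)
Definition a_map (x : 'rV[R]_2) : 'rV[R]_2 := point2 (x 0 ord_max) (x 0 ord0).
Definition b_map (x : 'rV[R]_2) : 'rV[R]_2 := point2 (x 0 ord0) (x 0 ord_max).

Lemma a_affine : affine a_map.
Proof. by move=> x y c; apply/rowP => j; rewrite !mxE; case: ifP => _; ring. Qed.

Lemma b_affine : affine b_map.
Proof. by move=> x y c; apply/rowP => j; rewrite !mxE; case: ifP => _; ring. Qed.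

Lemma a_cube x : std_simplex x -> cube (a_map x).
Proof. by move=> /std_simplex2P[h h']; exact: cube2P. Qed.

Lemma b_cube x : std_simplex x -> cube (b_map x).
Proof. by move=> /std_simplex2P[h h']; exact: cube2P. Qed.

Definition a_aff : affmap (@std_simplex R 2) (@cube R 2) := AffMap a_affine a_cube.
Definition b_aff : affmap (@std_simplex R 2) (@cube R 2) := AffMap b_affine b_cube.

Variable M : smooth_manifold R.

(* Delta_1 and I are both [0,1]. *)
Definition path_simplex (gamma : path1 M) : simplex M 1 := pull simplex1_aff gamma.

Definition path_inv (gamma : path1 M) : path1 M := pull rev_aff gamma.

Record path2 := Path2 {
  path2_map :> pwmap M (@cube R 2);
  path2_left : forall x y : @cube R 2,
    on_side ord0 0 x -> on_side ord0 0 y -> path2_map x = path2_map y;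
  path2_right : forall x y : @cube R 2,
    on_side ord0 1 x -> on_side ord0 1 y -> path2_map x = path2_map y }.

Definition slice (Gamma : path2) s (hs : 0 <= s <= 1) : path1 M :=
  pull (slice_aff hs) Gamma.

Lemma unit0 : 0 <= (0 : R) <= 1. Proof. by rewrite lexx ler01. Qed.
Lemma unit1 : 0 <= (1 : R) <= 1. Proof. by rewrite lexx ler01. Qed.

Definition path2_bottom (Gamma : path2) : path1 M := slice Gamma unit0.
Definition path2_top (Gamma : path2) : path1 M := slice Gamma unit1.

Definition path2_a (Gamma : path2) : simplex M 2 := pull a_aff Gamma.
Definition path2_b (Gamma : path2) : simplex M 2 := pull b_aff Gamma.

Definition path_concat (gamma gamma' : path1 M)
  (e : composable ord0 gamma gamma') : path1 M := concat e.

Lemma vconcat_side (c : R) (Gamma Gamma' : path2)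
    (e : composable (ord_max : 'I_2) Gamma Gamma') :
  (forall x y : @cube R 2, on_side ord0 c x -> on_side ord0 c y ->
    Gamma x = Gamma y) ->
  (forall x y : @cube R 2, on_side ord0 c x -> on_side ord0 c y ->
    Gamma' x = Gamma' y) -> 0 <= c <= 1 ->
  forall x y : @cube R 2, on_side ord0 c x -> on_side ord0 c y ->
    concat e x = concat e y.
Proof.
move=> h h' hc.
pose p (s : R) (hs : 0 <= s <= 1) : @cube R 2 := SigSub (mem_set (cube2P hc hs)).
have pc s hs : on_side ord0 c (@p s hs) by rewrite /on_side /= mxE.
have pp : Gamma (p _ unit1) = Gamma' (p _ unit0).
  apply: e; rewrite /on_side /= ?mxE//.
  move=> j jmax; rewrite /= !mxE; suff -> : j = ord0 by [].
  by apply/val_inj; case: j jmax => [[|[|]]].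
suff H (x : @cube R 2) : on_side ord0 c x -> concat e x = Gamma (p _ unit1).
  by move=> x y /H-> /H->.
move=> xc; rewrite /= /concat_fun; case: ifPn => [xs|].
  apply: h; last exact: pc.
  by rewrite /on_side concat_lo// mxE.
rewrite -ltNge => /ltW xs; rewrite pp; apply: h'; last exact: pc.
by rewrite /on_side concat_hi// mxE.
Qed.

(* Gamma' stacked on top of Gamma *)
Definition vconcat (Gamma Gamma' : path2)
    (e : composable (ord_max : 'I_2) Gamma Gamma') : path2 :=
  Path2 (vconcat_side e (@path2_left Gamma) (@path2_left Gamma') unit0)
        (vconcat_side e (@path2_right Gamma) (@path2_right Gamma') unit1).

Section Hconcat.
Variables (Gamma Gamma' : path2) (e : composable ord0 Gamma Gamma').

Lemma hconcat_left (x y : @cube R 2) :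
  on_side ord0 0 x -> on_side ord0 0 y -> concat e x = concat e y.
Proof.
move=> x0 y0; have h : 0 <= 2^-1 :> R by rewrite invr_ge0.
rewrite /= /concat_fun x0 y0 h; apply: path2_left.
  by rewrite /on_side concat_lo ?x0// mxE eqxx x0 mulr0 subr0.
by rewrite /on_side concat_lo ?y0// mxE eqxx y0 mulr0 subr0.
Qed.

Lemma hconcat_right (x y : @cube R 2) :
  on_side ord0 1 x -> on_side ord0 1 y -> concat e x = concat e y.
Proof.
move=> x1 y1; have h : (1 <= 2^-1 :> R) = false by apply/negbTE; rewrite -ltNge; lra.
have h' : 2^-1 <= 1 :> R by lra.
rewrite /= /concat_fun x1 y1 h; apply: path2_right.
  by rewrite /on_side concat_hi ?x1// mxE eqxx x1; ring.
by rewrite /on_side concat_hi ?y1// mxE eqxx y1; ring.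
Qed.

(* Gamma' placed to the right of Gamma *)
Definition hconcat : path2 := Path2 hconcat_left hconcat_right.

End Hconcat.

Definition boundary (x : @cube R 2) := exists i, on_side i 0 x \/ on_side i 1 x.

(* H(t,s,r), the homotopy parameter r being the last coordinate *)
Definition homotopic_rel_boundary (Gamma Gamma' : path2) :=
  exists H : pwmap M (@cube R 3), forall (y : @cube R 3) (x : @cube R 2),
    (forall i : 'I_2, (val x) 0 i = (val y) 0 (widen_ord (leqnSn 2) i)) ->
    [/\ on_side ord_max 0 y -> H y = Gamma x,
        on_side ord_max 1 y -> H y = Gamma' x &
        boundary x -> H y = Gamma x].

Record two_groupoid_rep (X : crossed_module) := TwoGroupoidRep {
  hol1 : path1 M -> cm_G X;
  hol2 : path2 -> cm_E X;
  hol1_const : forall gamma : path1 M,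
    (forall x y, gamma x = gamma y) -> hol1 gamma = 1%g;
  hol2_const : forall Gamma : path2,
    (forall x y, Gamma x = Gamma y) -> hol2 Gamma = 1%g;
  hol2_homotopy : forall Gamma Gamma' : path2,
    homotopic_rel_boundary Gamma Gamma' -> hol2 Gamma = hol2 Gamma';
  hol2_delta : forall Gamma : path2,
    cm_delta (hol2 Gamma) = ((hol1 (path2_bottom Gamma))^-1 * hol1 (path2_top Gamma))%g;
  hol1_concat : forall (gamma gamma' : path1 M)
    (e : composable ord0 gamma gamma'),
    hol1 (path_concat e) = (hol1 gamma' * hol1 gamma)%g;
  hol2_vconcat : forall (Gamma Gamma' : path2)
    (e : composable (ord_max : 'I_2) Gamma Gamma'),
    hol2 (vconcat e) = (hol2 Gamma * hol2 Gamma')%g;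
  hol2_hconcat : forall (Gamma Gamma' : path2)
    (e : composable ord0 Gamma Gamma'),
    hol2 (hconcat e) =
      (cm_act ((hol1 (path2_bottom Gamma))^-1)%g (hol2 Gamma') * hol2 Gamma)%g }.

End FundamentalTwoGroupoid.

Section RepUpToHomotopy.
Variables (R : realType) (M : smooth_manifold R) (V : cochain_complex R).

Definition cup p q (f : simplex M p -> 'End(V)) (g : simplex M q -> 'End(V))
    (sigma : simplex M (p + q)) : 'End(V) :=
  (f (front_face (cast_simplex (addnC p q) sigma)) \o g (back_face sigma))%VF.

Lemma ord_split n (j : 'I_n) : n = (j + (n - j))%N.
Proof. by rewrite subnKC// ltnW. Qed.

(* [ruth_map 0] is unconstrained: the family is indexed by n >= 1. *)
Record rep_up_to_homotopy := RepUpToHomotopy {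
  ruth_map :> forall n, simplex M n -> 'End(V);
  ruth_degree : forall n (sigma : simplex M n.+1),
    has_degree (1 - n.+1%:Z) (ruth_map sigma);
  ruth_eq : forall n (sigma : simplex M n.+1),
    bracket (1 - n.+1%:Z) (ruth_map sigma) =
      \sum_(1 <= j < n.+1) (-1) ^+ j *: ruth_map (face j sigma) +
      \sum_(j < n.+1 | (1 <= j)%N) (-1) ^+ j.+1 *:
        cup (@ruth_map j) (@ruth_map (n.+1 - j))
            (cast_simplex (ord_split j) sigma);
  ruth_unit : forall x : simplex M 0, ruth_map (degeneracy 0 x) = \1%VF;
  ruth_degenerate : forall n i (sigma : simplex M n), (0 < n)%N -> (i <= n)%N ->
    ruth_map (degeneracy i sigma) = 0 }.

Definition well_behaved (beta : rep_up_to_homotopy) :=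
  forall sigma : simplex M 2, thin sigma -> beta 2%N sigma = 0.

End RepUpToHomotopy.

(* Main.v *)
Require Import Defs.
From HB Require Import structures.
From mathcomp Require Import all_boot all_order all_algebra.
From mathcomp Require Import all_classical all_reals all_analysis.
From mathcomp Require Import ring lra ssrAC.

(* On paths, beta^1 is multiplicative with beta^1(gamma^-1) inverse to
   beta^1(gamma): the triangles (t, s) |-> gamma (t - s) and
   (t, s) |-> (gamma then gamma') ((t + s) / 2) are thin, so beta^2 vanishes on
   them and the equation becomes multiplicativity.  For surfaces, put
   W(Q) = beta^2(Q_b) - beta^2(Q_a).  Adding the equations for beta^3 on the
   three tetrahedra of a prism F(t, s, r), s >= r, with signs +, -, +, gives,
   modulo [d, End^-2],
     W(F(t,u,u)) = W(F(t,s,0)) beta^1(F(1,1,.)) + beta^1(F(0,.,0)) W(F(t,1,r))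
                   - beta^1(F(.,0,0)) beta^2(F(1,s,r))
                   + beta^2(F(0,s,r)) beta^1(F(.,1,1)).
   For a vertical composite C take F = C(t, (s + r) / 2), for a horizontal one
   F = C((s + r) / 2, t), and for a homotopy H relative to the boundary compare
   the prisms H(t, s, r) and H(t, r, s), which share the diagonal H(t, u, u). *)

Import Order.TTheory GRing.Theory Num.Theory.
Import numFieldNormedType.Exports.
Local Open Scope classical_set_scope.
Local Open Scope ring_scope.

(** * Piecewise smooth maps: constant maps, and maps of low rank *)

Section PiecewiseSmooth.
Context {R : realType} {M : smooth_manifold R}.

Lemma pwmap_ext n (D : set 'rV[R]_n) (f g : pwmap M D) : f =1 g -> f = g.
Proof.
case: f => f hf; case: g => g hg /= /funext fg.
by subst g; congr PwMap; exact: Prop_irrelevance.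
Qed.

Lemma Ck_on_cst k n m (W : set 'rV[R]_n) (w : 'rV[R]_m) :
  Ck_on k W (cst w).
Proof.
elim: k w => [|k IH] w /=; first by move=> x _; exact: cst_continuous.
split=> [x _|v]; first exact: differentiable_cst.
by rewrite (_ : 'D_v (cst w) = cst 0)//; apply/funext => x; rewrite derive_cst.
Qed.

Lemma piecewise_smooth_cst n (D : set 'rV[R]_n) (p : M) :
  piecewise_smooth (fun _ : D => p).
Proof.
exists unit, (fun=> setT); split=> [_||_ x _]; [exact: polyhedronT|by exists tt|].
have [c ac cp] := mfd_cover p.
exists c, setT, (cst (chart_map c p)); split=> //; first exact: openT.
by move=> k; exact: Ck_on_cst.
Qed.

(* The derivative of the map vanishes along any direction that the affine map
   kills. *)
Lemma thin_factor n m (D : set 'rV[R]_n) (f : pwmap M D)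
    (a : 'rV[R]_n -> 'rV[R]_m) : (m < n)%N -> affine a ->
  (forall x y : D, a (val x) = a (val y) -> f x = f y) -> thin f.
Proof.
move=> mn /affine_mx[A [b aE]] fa x c W g ac oW Wx WD sg gE.
have /rowV0Pn[v vA v0] : kermx A != 0.
  rewrite kermx_eq0 /row_free; apply: contraTN mn => /eqP <-.
  by rewrite -leqNgt rank_leq_col.
have Av : v *m A = 0 by apply/sub_kermxP.
have dg : differentiable g (val x) by have [/(_ _ Wx)] := sg 1%N.
have gv : 'D_v g (val x) = 0.
  rewrite /derive; apply: cvg_lim => //.
  (* For small [h] the point [val x + h v] stays in [W] and has the same image under [a], so the
     difference quotient is identically 0 near 0. *)
  apply: (@cvg_trans _ (cst (0 : 'rV[R]_(mfd_dim M)) @ 0^')); last exact: cvg_cst.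
  apply: near_eq_cvg; apply: cvg_within.
  have nW : \forall h \near (0 : R), W (h *: v + val x).
    have : (fun h : R => h *: v + val x) @ 0 --> (0 *: v + val x).
      by apply: cvgD; [apply: cvgZr_tmp; exact: cvg_id|exact: cvg_cst].
    by rewrite scale0r add0r; apply; exact: open_nbhs_nbhs.
  near=> h; have Wh : W (h *: v + val x) by near: h.
  pose y : D := SigSub (mem_set (WD _ Wh)).
  have fxy : f y = f x.
    by apply: fa; rewrite aE /= mulmxDl -scalemxAl Av scaler0 add0r.
  have [_ gy] := gE y Wh; have [_ gx] := gE x Wx.
  by rewrite /= -/(val y) -gy -gx fxy subrr scaler0.
(* A Jacobian of full row rank [n] would be injective on row vectors, but it kills the nonzero
   [v]. *)
rewrite ltn_neqAle rank_leq_row andbT; apply: contra v0 => fr.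
apply/eqP/(row_free_inj fr).
by rewrite mul0mx -deriveEjacobian.
Unshelve. all: by end_near.
Qed.

End PiecewiseSmooth.

(** * Coordinates of faces *)

Local Arguments simplex_coord : simpl never.

Section Simplices.
Context {R : realType}.

(** The conventions t_0 = 1 and t_l = 0 beyond the dimension let one formula cover the first, inner
    and last faces, for every [l]. *)
Lemma simplex_coord_face k i (x : 'rV[R]_k) l :
  simplex_coord (face_map i x) l.+1 = simplex_coord x (if (l < i)%N then l.+1 else l).
Proof.
have [lk|kl] := ltnP l k.+1; first by rewrite simplex_coordS mxE.
by rewrite !simplex_coord_out//; case: ifP => // _; exact: ltnW.
Qed.

End Simplices.

(** * Cup products in total degrees 2 and 3 *)

Section LowDegreeCups.
Context {R : realType} {M : smooth_manifold R} {V : cochain_complex R}.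

(** The dimensions related by the two casts are convertible numerals, so uniqueness of equality
    proofs on [nat] replaces both casts by [erefl] and the faces compute. The next two lemmas are
    obtained in the same way. *)
Lemma cup11E (f g : simplex M 1 -> 'End(V)) (e : 2 = (1 + 1)%N) sigma :
  cup (p := 1) (q := 1) f g (cast_simplex e sigma) =
  (f (face 2 sigma) \o g (face 0 sigma))%VF.
Proof.
have -> : e = erefl by exact: eq_irrelevance.
by rewrite /cup; have -> : addnC 1 1 = erefl by exact: eq_irrelevance.
Qed.

Lemma cup12E (f : simplex M 1 -> 'End(V)) (g : simplex M 2 -> 'End(V))
    (e : 3 = (1 + 2)%N) sigma :
  cup (p := 1) (q := 2) f g (cast_simplex e sigma) =
  (f (face 2 (face 3 sigma)) \o g (face 0 sigma))%VF.
Proof.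
have -> : e = erefl by exact: eq_irrelevance.
by rewrite /cup; have -> : addnC 1 2 = erefl by exact: eq_irrelevance.
Qed.

Lemma cup21E (f : simplex M 2 -> 'End(V)) (g : simplex M 1 -> 'End(V))
    (e : 3 = (2 + 1)%N) sigma :
  cup (p := 2) (q := 1) f g (cast_simplex e sigma) =
  (f (face 3 sigma) \o g (face 0 (face 0 sigma)))%VF.
Proof.
have -> : e = erefl by exact: eq_irrelevance.
by rewrite /cup; have -> : addnC 2 1 = erefl by exact: eq_irrelevance.
Qed.

End LowDegreeCups.

(** * Values of beta on simplices given by real coordinates, and the structure equations for n = 1,
    2, 3 *)

Section Evaluation.
Context {R : realType} {M : smooth_manifold R} {V : cochain_complex R}.
Variable beta : rep_up_to_homotopy M V.

Definition pw_simplex k (phi : 'rV[R]_k -> M) :=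
  piecewise_smooth (fun x : @std_simplex R k => phi (val x)).

(* Working with total maps of real coordinates makes the faces of a simplex
   plain substitutions; the value is 0 when [phi] is not a simplex. *)
Definition beta_at k (phi : 'rV[R]_k -> M) : 'End(V) :=
  if pselect (pw_simplex k phi) is left h then beta k (PwMap h) else 0.

Lemma beta_at_simplex k (phi : 'rV[R]_k -> M) (sigma : simplex M k) :
  (forall x, sigma x = phi (val x)) -> beta_at k phi = beta k sigma.
Proof.
move=> sE; rewrite /beta_at; case: pselect => [h|[]].
  by congr (beta k _); apply: pwmap_ext => x /=; rewrite sE.
rewrite /pw_simplex -(_ : pw_fun sigma = (fun x => phi (val x))).
  exact: pw_smooth.
exact/funext.
Qed.

(** Only the restriction to the simplex enters the definition, so [phi] and [psi] are simplices
    together or fail to be so together. *)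
Lemma beta_at_ext k (phi psi : 'rV[R]_k -> M) :
  (forall x, std_simplex x -> phi x = psi x) -> beta_at k phi = beta_at k psi.
Proof.
move=> e; have e' : (fun x : @std_simplex R k => phi (val x)) =
    (fun x : @std_simplex R k => psi (val x)).
  by apply/funext => x; apply: e; exact: set_mem (valP x).
rewrite /beta_at; case: pselect => [h|nh]; case: pselect => [h'|nh'] //.
- by congr (beta k _); apply: pwmap_ext => x /=; exact: (congr1 (@^~ x) e').
- by case: nh'; rewrite /pw_simplex -e'.
- by case: nh; rewrite /pw_simplex e'.
Qed.

Definition simplex1_fun (phi : R -> M) (x : 'rV[R]_1) := phi (simplex_coord x 1).
Definition simplex2_fun (phi : R -> R -> M) (x : 'rV[R]_2) :=
  phi (simplex_coord x 1) (simplex_coord x 2).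
Definition simplex3_fun (phi : R -> R -> R -> M) (x : 'rV[R]_3) :=
  phi (simplex_coord x 1) (simplex_coord x 2) (simplex_coord x 3).

Definition beta1 (phi : R -> M) := beta_at 1 (simplex1_fun phi).
Definition beta2 (phi : R -> R -> M) := beta_at 2 (simplex2_fun phi).

Lemma beta1_ext (phi psi : R -> M) : (forall t, 0 <= t <= 1 -> phi t = psi t) ->
  beta1 phi = beta1 psi.
Proof.
move=> e; apply: beta_at_ext => x hx; apply: e.
by rewrite std_simplex_ge0//= (std_simplex_mono hx (leq0n 1)).
Qed.

Lemma beta2_ext (phi psi : R -> R -> M) :
  (forall t s, 0 <= s -> s <= t -> t <= 1 -> phi t s = psi t s) ->
  beta2 phi = beta2 psi.
Proof.
move=> e; apply: beta_at_ext => x hx; apply: e.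
- exact: std_simplex_ge0.
- exact: std_simplex_mono.
- exact: (std_simplex_mono hx (leq0n 1)).
Qed.

Lemma beta1_degree phi : has_degree 0 (beta1 phi).
Proof.
rewrite /beta1 /beta_at; case: pselect => h; last exact: has_degree0.
by have := ruth_degree beta (PwMap h); rewrite subrr.
Qed.

Lemma beta2_degree phi : has_degree (-1) (beta2 phi).
Proof.
rewrite /beta2 /beta_at; case: pselect => h; last exact: has_degree0.
exact: (ruth_degree beta (PwMap h)).
Qed.

(** For n = 1 both sums in the structure equation are empty. *)
Lemma beta1_comm phi :
  (cc_d V \o beta1 phi)%VF = (beta1 phi \o cc_d V)%VF.
Proof.
rewrite /beta1 /beta_at; case: pselect => h; last first.
  by rewrite comp_lfun0l comp_lfun0r.
have := ruth_eq beta (PwMap h); rewrite /bracket /= expr0 scale1r.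
rewrite big_geq// add0r big_mkcond big_ord_recl big_ord0 /= => /eqP.
by rewrite addr0 subr_eq add0r => /eqP.
Qed.

(** A constant path is the degeneracy of a 0-simplex. *)
Lemma beta1_cst (phi : R -> M) p : (forall t, 0 <= t <= 1 -> phi t = p) ->
  beta1 phi = \1%VF.
Proof.
move=> e; rewrite (beta1_ext phi (fun=> p))//.
rewrite -(ruth_unit beta (PwMap (piecewise_smooth_cst _ _ p))).
exact: beta_at_simplex.
Qed.

(** A triangle depending only on the linear form [a t + b s] factors through a line, so its rank is
    at most 1. *)
Lemma beta2_thin (phi : R -> R -> M) (a b : R) : well_behaved beta ->
  (forall t s t' s', 0 <= s -> s <= t -> t <= 1 ->
     0 <= s' -> s' <= t' -> t' <= 1 ->
     a * t + b * s = a * t' + b * s' -> phi t s = phi t' s') ->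
  beta2 phi = 0.
Proof.
move=> hb e; rewrite /beta2 /beta_at; case: pselect => // h; apply: hb.
pose f (x : 'rV[R]_2) : 'rV[R]_1 :=
  const_mx (a * simplex_coord x 1 + b * simplex_coord x 2).
apply: (@thin_factor _ _ _ 1 _ _ f) => // [x y c|x y /rowP/(_ 0)].
  by apply/rowP => i; rewrite !(mxE, simplex_coord_affine); ring.
have hx := set_mem (valP x); have hy := set_mem (valP y).
rewrite !mxE; apply: e; try exact: std_simplex_ge0; try exact: std_simplex_mono.
- exact: (std_simplex_mono hx (leq0n 1)).
- exact: (std_simplex_mono hy (leq0n 1)).
Qed.

Lemma beta2_cst (phi : R -> R -> M) p : well_behaved beta ->
  (forall t s, 0 <= s -> s <= t -> t <= 1 -> phi t s = p) -> beta2 phi = 0.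
Proof.
move=> hb e; apply: (beta2_thin _ 0 0 hb) => t s t' s' *.
by rewrite !e.
Qed.

(** This is the structure equation for n = 2; the three paths are, in order, the faces d_2, d_0 and
    d_1. *)
Lemma bracket_beta2 phi : pw_simplex 2 (simplex2_fun phi) ->
  bracket (-1) (beta2 phi) =
  (beta1 (phi^~ 0%R) \o beta1 (phi 1))%VF - beta1 (fun t => phi t t).
Proof.
move=> h; rewrite /beta2 (beta_at_simplex _ _ (PwMap h))//.
have := ruth_eq beta (PwMap h) => ->.
rewrite big_nat1 big_mkcond !big_ord_recl big_ord0 /= add0r addr0.
rewrite [X in _ + _ *: X](cup11E (beta 1%N) (beta 1%N)).
rewrite expr1 scaleN1r sqrrN expr1n scale1r addrC /=.
congr (_ \o _ - _)%VF; symmetry; apply: beta_at_simplex => x;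
  by rewrite /simplex1_fun /= /simplex2_fun !simplex_coord_face /=
    ?(simplex_coord_out _ (ltnSn _)).
Qed.

(** This is the structure equation for n = 3, with beta^3 of the tetrahedron as the primitive in
    End^{-2}(V). The first two terms are d_2 and d_1, the others the two cup products. *)
Lemma exact_beta3 phi : pw_simplex 3 (simplex3_fun phi) ->
  exact_deg2 (beta2 (fun t s => phi t s s) - beta2 (fun t s => phi t t s) +
    (beta1 (fun t => phi t 0 0) \o beta2 (phi 1))%VF -
    (beta2 (fun t s => phi t s 0) \o beta1 (phi 1 1))%VF).
Proof.
move=> h; exists (beta 3 (PwMap h)); first exact: (ruth_degree beta (PwMap h)).
rewrite -[(- 2)%R]/(1 - 3%:Z) ruth_eq.
rewrite big_nat_recr//= big_nat1 big_mkcond !big_ord_recl big_ord0 /= add0r addr0.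
rewrite [X in _ + (_ *: X + _)](cup12E (beta 1%N) (beta 2%N)).
rewrite [X in _ + (_ + _ *: X)](cup21E (beta 2%N) (beta 1%N)).
rewrite expr1 scaleN1r sqrrN expr1n scale1r /=.
rewrite exprS sqrrN expr1n mulr1 scaleN1r scale1r.
rewrite [X in _ = X + _]addrC [in RHS]addrA.
congr (_ - _ + _ - _); [| |congr (_ \o _)%VF|congr (_ \o _)%VF];
  apply: beta_at_simplex => x;
  by rewrite /simplex1_fun /= /simplex3_fun /simplex2_fun /= !simplex_coord_face /=
    ?(simplex_coord_out _ (ltnSn _)).
Qed.

End Evaluation.

(** * Paths, 2-paths and their composites in real coordinates *)

Section CubeValues.
Context {R : realType} {M : smooth_manifold R}.

Lemma cube0_subproof n : cube (0 : 'rV[R]_n).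
Proof. by move=> i; rewrite mxE lexx ler01. Qed.

(* The default point 0 is only used outside the cube. *)
Definition cube_at n (f : pwmap M (@cube R n)) (v : 'rV[R]_n) : M :=
  f (insubd (SigSub (mem_set (cube0_subproof n)) : @cube R n) v).

Lemma cube_atE n (f : pwmap M (@cube R n)) (v : 'rV[R]_n) (x : @cube R n) :
  val x = v -> cube_at n f v = f x.
Proof. by move=> <-; rewrite /cube_at valKd. Qed.

Lemma pull_at n m (D : set 'rV[R]_n) (a : affmap D (@cube R m))
    (f : pwmap M (@cube R m)) (x : D) : pull a f x = cube_at m f (a (val x)).
Proof. exact/esym/cube_atE. Qed.

Lemma cube_at_pull n m (a : affmap (@cube R n) (@cube R m))
    (f : pwmap M (@cube R m)) (v : 'rV[R]_n) : cube v ->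
  cube_at n (pull a f) v = cube_at m f (a v).
Proof.
move=> hv; rewrite (cube_atE _ _ _ (SigSub (mem_set hv)))//.
exact: pull_at.
Qed.

Lemma pw_simplex_cube k m (f : pwmap M (@cube R m)) (a : 'rV[R]_k -> 'rV[R]_m) :
  affine a -> (forall x, std_simplex x -> cube (a x)) ->
  pw_simplex k (fun x => cube_at m f (a x)).
Proof.
move=> aa am; pose A : affmap (@std_simplex R k) (@cube R m) := AffMap aa am.
rewrite /pw_simplex (_ : (fun _ => _) = pull A f); first exact: pw_smooth.
by apply/funext => x; rewrite pull_at.
Qed.

Lemma concat_at_lo n (i : 'I_n) (f g : pwmap M (@cube R n))
    (e : composable i f g) (v : 'rV[R]_n) : cube v -> v 0 i <= 2^-1 ->
  cube_at n (concat e) v = cube_at n f (double_coord i 0 v).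
Proof.
move=> hv vi; rewrite (cube_atE _ _ _ (SigSub (mem_set hv)))//=.
by rewrite /concat_fun /= vi; symmetry; apply: cube_atE; rewrite concat_lo.
Qed.

Lemma concat_at_hi n (i : 'I_n) (f g : pwmap M (@cube R n))
    (e : composable i f g) (v : 'rV[R]_n) : cube v -> 2^-1 <= v 0 i ->
  cube_at n (concat e) v = cube_at n g (double_coord i 1 v).
Proof.
move=> hv vi; have [lo|hi] := leP (v 0 i) 2^-1; last first.
  rewrite (cube_atE _ _ _ (SigSub (mem_set hv)))//=.
  rewrite /concat_fun /= leNgt hi /=; symmetry; apply: cube_atE.
  by rewrite concat_hi.
(* On the seam [concat_fun] takes its value from [f]; composability identifies it with the value of
   [g]. *)
rewrite concat_at_lo//; have {vi lo} vi : v 0 i = 2^-1 by apply/le_anti/andP.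
have h c : (c == 0) || (c == 1) -> cube (double_coord i c v).
  move=> hc j; rewrite mxE; have := hv j; case: eqP => // -> _; rewrite vi.
  by case/orP: hc => /eqP ->; lra.
have h0 : cube (double_coord i 0 v) by apply: h; rewrite eqxx.
have h1 : cube (double_coord i 1 v) by apply: h; rewrite eqxx orbT.
rewrite (cube_atE _ f _ (SigSub (mem_set h0)))//.
rewrite (cube_atE _ g _ (SigSub (mem_set h1)))//.
apply: e; rewrite /on_side /agree_off /= ?mxE ?eqxx ?vi; [by field|by field|].
by move=> j /negPf ji; rewrite !mxE ji.
Qed.

Definition path_at (gamma : path1 M) (t : R) : M := cube_at 1 gamma (const_mx t).

Definition path2_at (Gamma : path2 M) (t s : R) : M :=
  cube_at 2 Gamma (point2 t s).

Lemma path_at_inv gamma t : 0 <= t <= 1 ->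
  path_at (path_inv gamma) t = path_at gamma (1 - t).
Proof.
move=> ht; rewrite /path_at cube_at_pull; last by move=> i; rewrite mxE.
by congr cube_at; apply/rowP => i; rewrite !mxE.
Qed.

Lemma path_at_slice Gamma s (hs : 0 <= s <= 1) t : 0 <= t <= 1 ->
  path_at (slice Gamma hs) t = path2_at Gamma t s.
Proof.
move=> ht; rewrite /path_at cube_at_pull; last by move=> i; rewrite mxE.
by congr cube_at; apply/rowP => i; rewrite !mxE.
Qed.

Lemma path2_at_left (Gamma : path2 M) s s' : 0 <= s <= 1 -> 0 <= s' <= 1 ->
  path2_at Gamma 0 s = path2_at Gamma 0 s'.
Proof.
have h0 : 0 <= (0 : R) <= 1 by rewrite lexx ler01.
move=> hs hs'; rewrite /path2_at.
rewrite (cube_atE _ _ _ (SigSub (mem_set (cube2P h0 hs))))//.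
rewrite (cube_atE _ _ _ (SigSub (mem_set (cube2P h0 hs'))))//.
by apply: path2_left; rewrite /on_side /= mxE.
Qed.

Lemma path2_at_right (Gamma : path2 M) s s' : 0 <= s <= 1 -> 0 <= s' <= 1 ->
  path2_at Gamma 1 s = path2_at Gamma 1 s'.
Proof.
have h1 : 0 <= (1 : R) <= 1 by rewrite lexx ler01.
move=> hs hs'; rewrite /path2_at.
rewrite (cube_atE _ _ _ (SigSub (mem_set (cube2P h1 hs))))//.
rewrite (cube_atE _ _ _ (SigSub (mem_set (cube2P h1 hs'))))//.
by apply: path2_right; rewrite /on_side /= mxE.
Qed.

Lemma path_concat_lo (gamma gamma' : path1 M) (e : composable ord0 gamma gamma') t :
  0 <= t <= 2^-1 -> path_at (path_concat e) t = path_at gamma (2 * t).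
Proof.
move=> ht; rewrite /path_at concat_at_lo ?mxE; try by case/andP: ht.
  by congr cube_at; apply/rowP => i; rewrite !mxE ord1 subr0.
by move=> i; rewrite mxE; lra.
Qed.

Lemma path_concat_hi (gamma gamma' : path1 M) (e : composable ord0 gamma gamma') t :
  2^-1 <= t <= 1 -> path_at (path_concat e) t = path_at gamma' (2 * t - 1).
Proof.
move=> ht; rewrite /path_at concat_at_hi ?mxE; try by case/andP: ht.
  by congr cube_at; apply/rowP => i; rewrite !mxE ord1.
by move=> i; rewrite mxE; lra.
Qed.

Lemma ord2_max : (ord_max : 'I_2) == ord0 = false. Proof. by []. Qed.

Lemma vconcat_lo (Gamma Gamma' : path2 M)
    (e : composable (ord_max : 'I_2) Gamma Gamma') t s : 0 <= t <= 1 ->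
  0 <= s <= 2^-1 -> path2_at (vconcat e) t s = path2_at Gamma t (2 * s).
Proof.
move=> ht hs; rewrite /path2_at concat_at_lo ?mxE ?ord2_max; try by case/andP: hs.
  congr cube_at; apply/rowP => i; rewrite !mxE.
  by case: i => [[|[|]]]//= ?; rewrite ?subr0.
by apply: cube2P => //; lra.
Qed.

Lemma vconcat_hi (Gamma Gamma' : path2 M)
    (e : composable (ord_max : 'I_2) Gamma Gamma') t s : 0 <= t <= 1 ->
  2^-1 <= s <= 1 -> path2_at (vconcat e) t s = path2_at Gamma' t (2 * s - 1).
Proof.
move=> ht hs; rewrite /path2_at concat_at_hi ?mxE ?ord2_max; try by case/andP: hs.
  congr cube_at; apply/rowP => i; rewrite !mxE.
  by case: i => [[|[|]]].
by apply: cube2P => //; lra.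
Qed.

Lemma hconcat_lo (Gamma Gamma' : path2 M) (e : composable ord0 Gamma Gamma') t s :
  0 <= t <= 2^-1 -> 0 <= s <= 1 ->
  path2_at (hconcat e) t s = path2_at Gamma (2 * t) s.
Proof.
move=> ht hs; rewrite /path2_at concat_at_lo ?mxE ?eqxx; try by case/andP: ht.
  congr cube_at; apply/rowP => i; rewrite !mxE.
  by case: i => [[|[|]]]//= ?; rewrite ?subr0.
by apply: cube2P => //; lra.
Qed.

Lemma hconcat_hi (Gamma Gamma' : path2 M) (e : composable ord0 Gamma Gamma') t s :
  2^-1 <= t <= 1 -> 0 <= s <= 1 ->
  path2_at (hconcat e) t s = path2_at Gamma' (2 * t - 1) s.
Proof.
move=> ht hs; rewrite /path2_at concat_at_hi ?mxE ?eqxx; try by case/andP: ht.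
  congr cube_at; apply/rowP => i; rewrite !mxE.
  by case: i => [[|[|]]].
by apply: cube2P => //; lra.
Qed.

End CubeValues.

(** * Multiplicativity of beta^1 on paths *)

Section Holonomy.
Context {R : realType} {M : smooth_manifold R} {V : cochain_complex R}.
Variable beta : rep_up_to_homotopy M V.
Hypothesis hbeta : well_behaved beta.

Local Notation B1 := (beta1 beta).
Local Notation B2 := (beta2 beta).

Lemma std_simplex2E (x : 'rV[R]_2) (t := simplex_coord x 1) (s := simplex_coord x 2) :
  std_simplex x -> 0 <= s /\ s <= t /\ t <= 1.
Proof.
move=> hx; split; first exact: std_simplex_ge0.
by split; [exact: std_simplex_mono|exact: (std_simplex_mono hx (leq0n 1))].
Qed.

Lemma std_simplex3E (x : 'rV[R]_3) (t := simplex_coord x 1)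
    (s := simplex_coord x 2) (r := simplex_coord x 3) :
  std_simplex x -> 0 <= r /\ r <= s /\ s <= t /\ t <= 1.
Proof.
move=> hx; split; first exact: std_simplex_ge0.
split; first exact: std_simplex_mono.
by split; [exact: std_simplex_mono|exact: (std_simplex_mono hx (leq0n 1))].
Qed.

(* The triangle factors through an interval, so it is thin. *)
Lemma beta1_triangle (gamma : path1 M) (a : R -> R -> R) (c0 c1 c2 : R) :
  (forall t s, a t s = c0 + c1 * t + c2 * s) ->
  (forall t s, 0 <= s -> s <= t -> t <= 1 -> 0 <= a t s <= 1) ->
  (B1 (fun t => path_at gamma (a t 0)) \o B1 (fun s => path_at gamma (a 1 s)))%VF =
  B1 (fun t => path_at gamma (a t t)).
Proof.
move=> aE a01; pose phi t s := path_at gamma (a t s).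
have h : pw_simplex 2 (simplex2_fun phi).
  apply: (pw_simplex_cube _ _ gamma
    (fun x : 'rV_2 => const_mx (a (simplex_coord x 1) (simplex_coord x 2)))).
    by move=> x y c; apply/rowP => i; rewrite !mxE !aE !simplex_coord_affine; ring.
  by move=> x /std_simplex2E[? []] *; rewrite /cube /= => i; rewrite mxE a01.
have := bracket_beta2 beta phi h.
rewrite (beta2_thin _ _ c1 c2 hbeta) ?bracketN1 ?comp_lfun0l ?comp_lfun0r ?addr0.
  by move/esym/eqP; rewrite subr_eq0 => /eqP.
move=> t s t' s' _ _ _ _ _ _ e; rewrite /phi; congr path_at.
by rewrite !aE -!addrA e.
Qed.

(** In the triangle gamma(t - s) the edge s = 0 is gamma, the edge t = 1 is its inverse, and the
    diagonal is constant. *)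
Lemma beta1_invr (gamma : path1 M) :
  (B1 (path_at gamma) \o B1 (fun t => path_at gamma (1 - t)))%VF = \1%VF.
Proof.
have := @beta1_triangle gamma (fun t s => t - s) 0 1 (-1).
rewrite [in RHS](beta1_cst beta _ (path_at gamma 0)); last by move=> t _; rewrite subrr.
rewrite (beta1_ext _ (fun t => path_at gamma (t - 0)) (path_at gamma)); last first.
  by move=> t _; rewrite subr0.
by apply=> [t s|t s hs st t1]; [ring|lra].
Qed.

(** This uses the preceding triangle for the reversed path; its diagonal is constant at gamma(1). *)
Lemma beta1_invl (gamma : path1 M) :
  (B1 (fun t => path_at gamma (1 - t)) \o B1 (path_at gamma))%VF = \1%VF.
Proof.
have := @beta1_triangle gamma (fun t s => 1 - (t - s)) 1 (-1) 1.
rewrite [in RHS](beta1_cst beta _ (path_at gamma 1)); last first.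
  by move=> t _; rewrite subrr subr0.
rewrite (beta1_ext _ (fun t => path_at gamma (1 - (1 - t))) (path_at gamma));
  last first.
  by move=> t _; rewrite opprB addrC subrK.
rewrite (beta1_ext _ (fun t => path_at gamma (1 - (t - 0)))
  (fun t => path_at gamma (1 - t))); last by move=> t _; rewrite subr0.
by apply=> [t s|t s hs st t1]; [ring|lra].
Qed.

(** The order is that of front face, then back face; taking inverses in [hol_path] turns it into the
    order required of a 2-groupoid representation. *)
Lemma beta1_concat (gamma gamma' : path1 M) (e : composable ord0 gamma gamma') :
  B1 (path_at (path_concat e)) = (B1 (path_at gamma) \o B1 (path_at gamma'))%VF.
Proof.
have := @beta1_triangle (path_concat e) (fun t s => (t + s) / 2) 0 2^-1 2^-1.
rewrite (beta1_ext _ (fun t => path_at (path_concat e) ((t + 0) / 2)) (path_at gamma));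
  last first.
  by move=> t ht; rewrite path_concat_lo; [congr path_at; field|lra].
rewrite (beta1_ext _ (fun t => path_at (path_concat e) ((1 + t) / 2)) (path_at gamma'));
  last first.
  by move=> t ht; rewrite path_concat_hi; [congr path_at; field|lra].
rewrite (beta1_ext _ (fun t => path_at (path_concat e) ((t + t) / 2))
  (path_at (path_concat e))); last by move=> t _; congr path_at; field.
by move=> h; rewrite h // => [t s|t s hs st t1]; [ring|lra].
Qed.

(** * The value W of a square and the prism relation *)

Definition square_value (phi : R -> R -> M) : 'End(V) :=
  B2 phi - B2 (fun t s => phi s t).

(** The two triangles share the diagonal, whose terms cancel; what remains are the two ways around
    the boundary. *)
Lemma bracket_square_value phi :
  pw_simplex 2 (simplex2_fun phi) ->
  pw_simplex 2 (simplex2_fun (fun t s => phi s t)) ->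
  bracket (-1) (square_value phi) =
  (B1 (phi^~ 0) \o B1 (phi 1))%VF - (B1 (phi 0) \o B1 (phi^~ 1))%VF.
Proof.
move=> h h'; rewrite /square_value bracketB bracket_beta2// (bracket_beta2 _ _ h').
by rewrite opprB addrA subrK.
Qed.

(** Each bracket is one tetrahedron of the prism. The terms [q] and [u] are the interior triangles t
    = s and t = r, each shared by two adjacent tetrahedra. *)
Lemma addr_cancel_prism (W : zmodType) (p p' q m n u v w y z : W) :
  (p - q + m - n) - (u - q + v - w) + (u - p' + y - z) =
  (p - p') + m - (n - w) - (v - y) - z.
Proof.
rewrite !(opprD, opprK).
rewrite [LHS](AC ((4*4)*4) ((((((1*10)*3)*(4*8))*(7*11))*12)*((2*6)*(5*9))))/=.
by rewrite !addNr !addr0.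
Qed.

(* The prism Delta_1 x Delta_2 with coordinates (t, (s, r)) is the union of the
   three tetrahedra t >= s >= r, s >= t >= r and s >= r >= t. *)
Lemma exact_prism (F : R -> R -> R -> M) :
  pw_simplex 3 (simplex3_fun F) ->
  pw_simplex 3 (simplex3_fun (fun s t r => F t s r)) ->
  pw_simplex 3 (simplex3_fun (fun s r t => F t s r)) ->
  exact_deg2 (square_value (fun t u => F t u u)
    + (B1 (fun t => F t 0 0) \o B2 (F 1))%VF
    - (square_value (fun t s => F t s 0) \o B1 (F 1 1))%VF
    - (B1 (fun s => F 0 s 0) \o square_value (fun t r => F t 1 r))%VF
    - (B2 (F 0) \o B1 (fun t => F t 1 1))%VF).
Proof.
move=> h1 h2 h3.
have e1 := exact_beta3 beta _ h1.
have e2 := exact_beta3 beta _ h2.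
have e3 := exact_beta3 beta _ h3.
have := exact_deg2D (exact_deg2D e1 (exact_deg2N e2)) e3.
rewrite addr_cancel_prism /square_value.
by rewrite comp_lfunDl comp_lfunNl comp_lfunDr comp_lfunNr.
Qed.

End Holonomy.

(** * Prism relations for vertical and horizontal composites and for homotopies *)

Section Surfaces.
Context {R : realType} {M : smooth_manifold R} {V : cochain_complex R}.
Variable beta : rep_up_to_homotopy M V.
Hypothesis hbeta : well_behaved beta.

Local Notation B1 := (beta1 beta).
Local Notation B2 := (beta2 beta).
Local Notation W := (square_value beta).

Definition affine_fun k (a : 'rV[R]_k -> R) := forall x y c,
  a (c *: x + (1 - c) *: y) = c * a x + (1 - c) * a y.

Lemma pw_simplex_path2 k (Gamma : path2 M) (a b : 'rV[R]_k -> R) :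
  affine_fun k a -> affine_fun k b ->
  (forall x, std_simplex x -> 0 <= a x <= 1) ->
  (forall x, std_simplex x -> 0 <= b x <= 1) ->
  pw_simplex k (fun x => path2_at Gamma (a x) (b x)).
Proof.
move=> aa ab a01 b01; apply: (pw_simplex_cube _ _ Gamma (fun x => point2 (a x) (b x))).
  by move=> x y c; apply/rowP => i; rewrite !mxE aa ab; case: ifP.
by move=> x hx; apply: cube2P; [exact: a01|exact: b01].
Qed.

Definition point3 (t s r : R) : 'rV[R]_3 :=
  \row_j (if j == ord_max then r else if j == ord0 then t else s).

Definition cube3_at (H : pwmap M (@cube R 3)) t s r := cube_at 3 H (point3 t s r).

Lemma pw_simplex_cube3 k (H : pwmap M (@cube R 3)) (a b c : 'rV[R]_k -> R) :
  affine_fun k a -> affine_fun k b -> affine_fun k c ->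
  (forall x, std_simplex x -> 0 <= a x <= 1) ->
  (forall x, std_simplex x -> 0 <= b x <= 1) ->
  (forall x, std_simplex x -> 0 <= c x <= 1) ->
  pw_simplex k (fun x => cube3_at H (a x) (b x) (c x)).
Proof.
move=> aa ab ac a01 b01 c01.
apply: (pw_simplex_cube _ _ H (fun x => point3 (a x) (b x) (c x))).
  by move=> x y d; apply/rowP => i; rewrite !mxE aa ab ac; do 2 case: ifP => _ //.
move=> x hx i; rewrite mxE; case: ifP => _; first exact: c01.
by case: ifP => _; [exact: a01|exact: b01].
Qed.

Lemma square_value_ext phi psi : (forall t s, 0 <= t <= 1 -> 0 <= s <= 1 ->
  phi t s = psi t s) -> W phi = W psi.
Proof.
by move=> e; congr (_ - _); apply: beta2_ext => t s s0 st t1; apply: e; lra.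
Qed.

Lemma square_value_opp phi : W (fun t s => phi s t) = - W phi.
Proof. by rewrite /square_value opprB. Qed.

(** Both triangles depend on a single coordinate, so both are thin. *)
Lemma square_value_const_r (phi : R -> R -> M) :
  (forall t s, 0 <= t <= 1 -> 0 <= s <= 1 -> phi t s = phi t 0) -> W phi = 0.
Proof.
move=> e; rewrite /square_value (beta2_thin beta _ 1 0 hbeta); last first.
  move=> t s t' s' s0 st t1 s'0 st' t'1; rewrite !mul1r !mul0r !addr0 => tt.
  by rewrite e ?[RHS]e ?tt//; lra.
rewrite (beta2_thin beta _ 0 1 hbeta) ?subrr//.
move=> t s t' s' s0 st t1 s'0 st' t'1; rewrite !mul1r !mul0r !add0r => tt.
by rewrite e ?[RHS]e ?tt//; lra.
Qed.

Ltac affine_tac := by move=> x y c; rewrite !simplex_coord_affine; ring.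
Ltac bounds2_tac := by move=> x /std_simplex2E; lra.
Ltac bounds3_tac := by move=> x /std_simplex3E; lra.

(** The vertical sides of a 2-path are constant, so beta^1 is the identity on them. *)
Lemma bracket_path2 (Gamma : path2 M) :
  bracket (-1) (W (path2_at Gamma)) =
  B1 ((path2_at Gamma)^~ 0) - B1 ((path2_at Gamma)^~ 1).
Proof.
rewrite bracket_square_value.
- rewrite (beta1_cst beta (path2_at Gamma 1) (path2_at Gamma 1 0)); last first.
    by move=> t ht; apply: path2_at_right => //; lra.
  rewrite (beta1_cst beta (path2_at Gamma 0) (path2_at Gamma 0 0)).
    by rewrite comp_lfun1r comp_lfun1l.
  by move=> t ht; apply: path2_at_left => //; lra.
- by apply: pw_simplex_path2; first [affine_tac|bounds2_tac].
- by apply: pw_simplex_path2; first [affine_tac|bounds2_tac].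
Qed.

Lemma exact_prism_thin_ends (F : R -> R -> R -> M) :
  pw_simplex 3 (simplex3_fun F) ->
  pw_simplex 3 (simplex3_fun (fun s t r => F t s r)) ->
  pw_simplex 3 (simplex3_fun (fun s r t => F t s r)) ->
  B2 (F 0) = 0 -> B2 (F 1) = 0 ->
  exact_deg2 (W (fun t u => F t u u)
    - (W (fun t s => F t s 0) \o B1 (F 1 1))%VF
    - (B1 (fun s => F 0 s 0) \o W (fun t r => F t 1 r))%VF).
Proof.
move=> h1 h2 h3 F0 F1; have := exact_prism beta F h1 h2 h3.
by rewrite F0 F1 comp_lfun0r comp_lfun0l addr0 subr0.
Qed.

Lemma exact_prism_const_ends (F : R -> R -> R -> M) (p q : M) :
  pw_simplex 3 (simplex3_fun F) ->
  pw_simplex 3 (simplex3_fun (fun s t r => F t s r)) ->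
  pw_simplex 3 (simplex3_fun (fun s r t => F t s r)) ->
  (forall s r, 0 <= s <= 1 -> 0 <= r <= 1 -> F 0 s r = p) ->
  (forall s r, 0 <= s <= 1 -> 0 <= r <= 1 -> F 1 s r = q) ->
  exact_deg2 (W (fun t u => F t u u) - W (fun t s => F t s 0) -
    W (fun t r => F t 1 r)).
Proof.
move=> h1 h2 h3 F0 F1; have := exact_prism_thin_ends F h1 h2 h3.
rewrite (beta2_cst beta (F 0) p hbeta) => [|s r *]; last by apply: F0; lra.
rewrite (beta2_cst beta (F 1) q hbeta) => [|s r *]; last by apply: F1; lra.
rewrite (beta1_cst beta (F 1 1) q) => [|r hr]; last by apply: F1; lra.
rewrite (beta1_cst beta (fun s => F 0 s 0) p) => [|r hr]; last by apply: F0; lra.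
by rewrite comp_lfun1l comp_lfun1r; apply.
Qed.

Lemma exact_vconcat (Gamma Gamma' : path2 M)
    (e : composable (ord_max : 'I_2) Gamma Gamma') :
  exact_deg2 (W (path2_at (vconcat e)) - W (path2_at Gamma) - W (path2_at Gamma')).
Proof.
(* The face r = 0 traces the lower half, s = 1 the upper half and s = r the whole composite; the
   ends t = 0 and t = 1 lie in the constant sides. *)
pose F t s r := path2_at (vconcat e) t ((s + r) / 2).
rewrite (square_value_ext (path2_at (vconcat e)) (fun t u => F t u u)); last first.
  by move=> t u _ _; rewrite /F; congr path2_at; field.
rewrite (square_value_ext (path2_at Gamma) (fun t s => F t s 0)); last first.
  by move=> t s ht hs; rewrite /F vconcat_lo//; [congr path2_at; field|lra].
rewrite (square_value_ext (path2_at Gamma') (fun t r => F t 1 r)); last first.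
  by move=> t s ht hs; rewrite /F vconcat_hi//; [congr path2_at; field|lra].
apply: (exact_prism_const_ends F (path2_at (vconcat e) 0 0) (path2_at (vconcat e) 1 0)).
- by apply: pw_simplex_path2; first [affine_tac|bounds3_tac].
- by apply: pw_simplex_path2; first [affine_tac|bounds3_tac].
- by apply: pw_simplex_path2; first [affine_tac|bounds3_tac].
- by move=> s r hs hr; apply: path2_at_left; lra.
- by move=> s r hs hr; apply: path2_at_right; lra.
Qed.

Lemma exact_hconcat (Gamma Gamma' : path2 M) (e : composable ord0 Gamma Gamma') :
  exact_deg2 (W (path2_at (hconcat e))
    - (B1 ((path2_at Gamma)^~ 0) \o W (path2_at Gamma'))%VF
    - (W (path2_at Gamma) \o B1 ((path2_at Gamma')^~ 1))%VF).
Proof.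
pose F t s r := path2_at (hconcat e) ((s + r) / 2) t.
(* The ends are not constant here, but they depend on [s + r] alone. *)
have F_thin t : B2 (F t) = 0.
  apply: (beta2_thin _ _ 1 1 hbeta) => s r s' r' _ _ _ _ _ _.
  by rewrite !mul1r /F => ->.
have : exact_deg2 _ := exact_prism_thin_ends F _ _ _ (F_thin 0) (F_thin 1).
rewrite (square_value_ext (fun t u => F t u u) (fun t s => path2_at (hconcat e) s t));
  last by move=> t u _ _; rewrite /F; congr path2_at; field.
rewrite (square_value_ext (fun t s => F t s 0) (fun t s => path2_at Gamma s t));
  last first.
  by move=> t s ht hs; rewrite /F hconcat_lo//; [congr path2_at; field|lra].
rewrite (square_value_ext (fun t r => F t 1 r) (fun t s => path2_at Gamma' s t));
  last first.
  by move=> t s ht hs; rewrite /F hconcat_hi//; [congr path2_at; field|lra].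
rewrite (beta1_ext beta (F 1 1) ((path2_at Gamma')^~ 1)); last first.
  by move=> t ht; rewrite /F hconcat_hi//; [congr path2_at; field|lra|lra].
rewrite (beta1_ext beta (fun s => F 0 s 0) ((path2_at Gamma)^~ 0)); last first.
  by move=> t ht; rewrite /F hconcat_lo//; [congr path2_at; field|lra|lra].
(* All three squares occur transposed, so the prism relation is the negative of the claim. *)
rewrite (square_value_opp (path2_at (hconcat e))) (square_value_opp (path2_at Gamma)).
rewrite (square_value_opp (path2_at Gamma')) comp_lfunNl comp_lfunNr !opprK => h.
rewrite addrAC -[X in exact_deg2 X]opprK; apply: exact_deg2N.
rewrite 2!opprD !opprK.
by apply: h; apply: pw_simplex_path2; first [affine_tac|bounds3_tac].
Qed.

Lemma homotopy_at (Gamma Gamma' : path2 M) :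
  homotopic_rel_boundary Gamma Gamma' ->
  exists H : pwmap M (@cube R 3), forall t s r,
    0 <= t <= 1 -> 0 <= s <= 1 -> 0 <= r <= 1 ->
  [/\ r = 0 -> cube3_at H t s r = path2_at Gamma t s,
      r = 1 -> cube3_at H t s r = path2_at Gamma' t s &
      [\/ t = 0, t = 1, s = 0 | s = 1] -> cube3_at H t s r = path2_at Gamma t s].
Proof.
move=> [H HE]; exists H => t s r ht hs hr.
have cube3P : cube (point3 t s r) by move=> i; rewrite mxE; do 2 case: ifP => _ //.
have [] := HE (SigSub (mem_set cube3P)) (SigSub (mem_set (cube2P ht hs))).
  by move=> i; rewrite /= !mxE; case: i => [[|[|]]].
rewrite /cube3_at /path2_at !(cube_atE _ _ _ (SigSub (mem_set cube3P)))//.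
rewrite !(cube_atE _ _ _ (SigSub (mem_set (cube2P ht hs))))// => h0 h1 hb.
split=> [r0|r1|b]; [apply: h0|apply: h1|apply: hb]; rewrite /on_side /= ?mxE//.
by case: b => b; [exists ord0|exists ord0|exists ord_max|exists ord_max];
  rewrite /on_side /= !mxE /=; [left|right|left|right].
Qed.

(** The points H(t, 1, 1) lie both on the end r = 1 and over the fixed boundary. *)
Lemma homotopic_top (Gamma Gamma' : path2 M) t :
  homotopic_rel_boundary Gamma Gamma' -> 0 <= t <= 1 ->
  path2_at Gamma t 1 = path2_at Gamma' t 1.
Proof.
move=> /homotopy_at[H H_at] ht; have i1 : 0 <= (1 : R) <= 1 by rewrite lexx ler01.
by have [_ <- // <-] := H_at _ _ _ ht i1 i1; last by constructor 4.
Qed.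

Lemma exact_homotopy (Gamma Gamma' : path2 M) :
  homotopic_rel_boundary Gamma Gamma' ->
  exact_deg2 (W (path2_at Gamma) - W (path2_at Gamma')).
Proof.
move=> /homotopy_at[H H_at].
have i0 : 0 <= (0 : R) <= 1 by rewrite lexx ler01.
have i1 : 0 <= (1 : R) <= 1 by rewrite lexx ler01.
have H0 s r : 0 <= s <= 1 -> 0 <= r <= 1 -> cube3_at H 0 s r = path2_at Gamma 0 0.
  move=> hs hr; have [_ _ ->] := H_at _ _ _ i0 hs hr; last by constructor 1.
  exact: path2_at_left.
have H1 s r : 0 <= s <= 1 -> 0 <= r <= 1 -> cube3_at H 1 s r = path2_at Gamma 1 0.
  move=> hs hr; have [_ _ ->] := H_at _ _ _ i1 hs hr; last by constructor 2.
  exact: path2_at_right.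
(* The face r = 0 of this prism is [Gamma]; the face s = 1 does not depend on r, because [H] is
   fixed on the boundary, so its W vanishes. *)
have low : exact_deg2 (W (fun t u => cube3_at H t u u) - W (path2_at Gamma)).
  have := exact_prism_const_ends (cube3_at H) _ _ _ _ _ H0 H1.
  rewrite (square_value_ext (fun t s => cube3_at H t s 0) (path2_at Gamma)); last first.
    by move=> t s ht hs; have [->] := H_at _ _ _ ht hs i0.
  rewrite (square_value_const_r (fun t r => cube3_at H t 1 r)); last first.
    move=> t r ht hr; have [_ _ ->] := H_at _ _ _ ht i1 hr; last by constructor 4.
    by have [_ _ ->] := H_at _ _ _ ht i1 i0; last by constructor 4.
  by rewrite subr0; apply; apply: pw_simplex_cube3; first [affine_tac|bounds3_tac].
(* With the last two coordinates exchanged, the face at homotopy parameter 1 is [Gamma'], and the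
   face over the bottom edge contributes 0. *)
have high : exact_deg2 (W (fun t u => cube3_at H t u u) - W (path2_at Gamma')).
  have := exact_prism_const_ends (fun t s r => cube3_at H t r s) _ _ _ _ _
    (fun s r hs hr => H0 r s hr hs) (fun s r hs hr => H1 r s hr hs).
  rewrite (square_value_ext (fun t r => cube3_at H t r 1) (path2_at Gamma'));
    last first.
    by move=> t s ht hs; have [_ ->] := H_at _ _ _ ht hs i1.
  rewrite (square_value_const_r (fun t r => cube3_at H t 0 r)); last first.
    move=> t r ht hr; have [_ _ ->] := H_at _ _ _ ht i0 hr; last by constructor 3.
    by have [_ _ ->] := H_at _ _ _ ht i0 i0; last by constructor 3.
  by rewrite subr0; apply; apply: pw_simplex_cube3; first [affine_tac|bounds3_tac].
have := exact_deg2D (exact_deg2N low) high.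
by rewrite opprB addrA subrK.
Qed.

End Surfaces.

(** * The truncated representation and its axioms *)

Section Representation.
Context {R : realType} {M : smooth_manifold R} {V : cochain_complex R}.
Variable beta : rep_up_to_homotopy M V.
Hypothesis hbeta : well_behaved beta.

Local Notation B1 := (beta1 beta).
Local Notation W := (square_value beta).

Lemma beta_path (gamma : path1 M) :
  beta 1 (path_simplex gamma) = B1 (path_at gamma).
Proof.
symmetry; apply: beta_at_simplex => x.
rewrite pull_at /= /simplex1_fun /path_at; congr cube_at.
apply/rowP => i; rewrite mxE (@simplex_coordS R 1 _ 0 isT).
by congr (_ _ _); apply/val_inj; rewrite ord1.
Qed.

Lemma beta_path_inv (gamma : path1 M) :
  beta 1 (path_simplex (path_inv gamma)) = B1 (fun t => path_at gamma (1 - t)).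
Proof. by rewrite beta_path; apply: beta1_ext => t; exact: path_at_inv. Qed.

Lemma simplex2_coordE (x : 'rV[R]_2) :
  x 0 ord0 = simplex_coord x 1 /\ x 0 ord_max = simplex_coord x 2.
Proof.
by split; [rewrite (@simplex_coordS R 2 _ 0 isT)|rewrite (@simplex_coordS R 2 _ 1 isT)];
  congr (x 0 _); apply/val_inj.
Qed.

Lemma beta_square (Gamma : path2 M) :
  beta 2 (path2_b Gamma) - beta 2 (path2_a Gamma) = W (path2_at Gamma).
Proof.
congr (_ - _); symmetry; apply: beta_at_simplex => x;
  rewrite pull_at /= /a_map /b_map /simplex2_fun;
  by have [-> ->] := simplex2_coordE (val x).
Qed.

Lemma hol_path_subproof (gamma : path1 M) :
  gl0_pred (beta 1 (path_simplex (path_inv gamma))).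
Proof.
rewrite beta_path_inv; apply/asboolP; split.
- exact: beta1_degree.
- exact: beta1_comm.
- by exists (B1 (path_at gamma)); split; [exact: beta1_invr|exact: beta1_invl].
Qed.
Definition hol_path gamma : gl0 V := Gl0 (hol_path_subproof gamma).

(** The inverse holonomy is beta^1 of the path itself, so identities between holonomies are checked
    on inverses, without reversing paths. *)
Lemma hol_pathV gamma : gl0_val (hol_path gamma)^-1%g = B1 (path_at gamma).
Proof.
have kh := lker0_compVf (gl0_ker (hol_path gamma)).
rewrite -[LHS]comp_lfun1r -(beta1_invl beta hbeta gamma) comp_lfunA.
by rewrite -beta_path_inv [X in (X \o _)%VF]kh comp_lfun1l.
Qed.

Lemma hol_path_ext gamma gamma' :
  (forall t, 0 <= t <= 1 -> path_at gamma t = path_at gamma' t) ->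
  hol_path gamma = hol_path gamma'.
Proof.
move=> e; apply: invg_inj; apply/val_inj.
by rewrite [LHS]hol_pathV [RHS]hol_pathV; exact: beta1_ext.
Qed.

Lemma hol_path_slice (Gamma : path2 M) s (hs : 0 <= s <= 1) :
  gl0_val (hol_path (slice Gamma hs))^-1%g = B1 ((path2_at Gamma)^~ s).
Proof. by rewrite hol_pathV; apply: beta1_ext => t; exact: path_at_slice. Qed.

Lemma hol_path_const (gamma : path1 M) :
  (forall x y, gamma x = gamma y) -> hol_path gamma = 1%g.
Proof.
move=> e; apply: invg_inj; rewrite invg1; apply/val_inj; rewrite [LHS]hol_pathV.
by apply: (beta1_cst _ _ (path_at gamma 0)) => t _; exact: e.
Qed.

Lemma hol_path_concat (gamma gamma' : path1 M) (e : composable ord0 gamma gamma') :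
  hol_path (path_concat e) = (hol_path gamma' * hol_path gamma)%g.
Proof.
apply: invg_inj; rewrite invgM; apply/val_inj; rewrite [LHS]hol_pathV /=.
by rewrite beta1_concat// -!hol_pathV.
Qed.

Definition surface_value (Gamma : path2 M) : 'End(V) :=
  ((beta 2 (path2_b Gamma) - beta 2 (path2_a Gamma))
     \o beta 1 (path_simplex (path_inv (path2_top Gamma))))%VF.

Lemma surface_valueE Gamma :
  surface_value Gamma = (W (path2_at Gamma) \o hol_path (path2_top Gamma))%VF.
Proof. by rewrite /surface_value beta_square. Qed.

Lemma bracketN1_compr (s : 'End(V)) (f : gl0 V) :
  bracket (-1) (s \o f)%VF = (bracket (-1) s \o f)%VF.
Proof.
by rewrite !bracketN1 comp_lfunDl -!comp_lfunA gl0_comm.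
Qed.

(** Since beta^1 of the top edge is inverse to its holonomy, the top term of [bracket_path2] becomes
    - id and cancels the unit. This yields both the invertibility that defines End^{-1}(V)' and the
    axiom on delta. *)
Lemma bracket_surface_value Gamma :
  bracket (-1) (surface_value Gamma) + \1%VF =
  gl0_val ((hol_path (path2_bottom Gamma))^-1 * hol_path (path2_top Gamma))%g.
Proof.
rewrite surface_valueE bracketN1_compr bracket_path2// -(hol_path_slice _ _ (unit0 R)).
rewrite -(hol_path_slice _ _ (unit1 R)) comp_lfunDl comp_lfunNl.
have /(congr1 (@gl0_val R V)) /= -> := mulVg (hol_path (path2_top Gamma)).
by rewrite subrK.
Qed.

Lemma surface_subproof Gamma : glm1_pred (surface_value Gamma).
Proof.
apply/asboolP; rewrite bracket_surface_value; split; last exact: gl0_inv.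
rewrite surface_valueE.
have dW : has_degree (-1) (W (path2_at Gamma)).
  by apply: has_degreeD; [|apply: has_degreeN]; exact: beta2_degree.
by have := has_degree_comp dW (gl0_deg (hol_path (path2_top Gamma))); rewrite add0r.
Qed.
Definition surface_elt Gamma : glm1' V := Glm1' (surface_subproof Gamma).
Definition hol_surface Gamma : glm1 V := glm1_class (surface_elt Gamma).

Lemma hol_surface_const (Gamma : path2 M) : (forall x y, Gamma x = Gamma y) ->
  hol_surface Gamma = 1%g.
Proof.
move=> e; congr glm1_class; apply/val_inj; rewrite /= surface_valueE.
rewrite (square_value_const_r beta hbeta) ?comp_lfun0l// => t s _ _.
exact: e.
Qed.

Lemma hol_surface_homotopy Gamma Gamma' : homotopic_rel_boundary Gamma Gamma' ->
  hol_surface Gamma = hol_surface Gamma'.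
Proof.
move=> h; apply/glm1_classP; rewrite /= !surface_valueE.
have -> : hol_path (path2_top Gamma') = hol_path (path2_top Gamma).
  apply: hol_path_ext => t ht; rewrite !path_at_slice//.
  by rewrite (homotopic_top _ _ _ h).
rewrite -comp_lfunNl -comp_lfunDl.
by apply: exact_deg2_compr; [exact: gl0_deg|exact: gl0_comm|exact: exact_homotopy].
Qed.

Lemma hol_surface_delta Gamma : GL_delta (hol_surface Gamma) =
  ((hol_path (path2_bottom Gamma))^-1 * hol_path (path2_top Gamma))%g.
Proof.
by rewrite GL_deltaE; apply/val_inj; exact: bracket_surface_value.
Qed.

(** For a surface value S, grouping s + s[d, S] = s([d, S] + id) turns the product into a
    composition with delta(S), which is known in terms of the edges. *)
Lemma glm1_op_surface (s : 'End(V)) Gamma : glm1_op s (surface_value Gamma) =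
  (s \o gl0_val ((hol_path (path2_bottom Gamma))^-1 * hol_path (path2_top Gamma))%g)%VF
  + surface_value Gamma.
Proof.
rewrite -bracket_surface_value comp_lfunDr comp_lfun1r /glm1_op.
by rewrite addrAC; congr (_ + _); exact: addrC.
Qed.

Lemma comp_gl0M (s : 'End(V)) (f g : gl0 V) :
  ((s \o f) \o g)%VF = (s \o gl0_val (f * g)%g)%VF.
Proof. by rewrite -comp_lfunA. Qed.

Lemma hol_surface_vconcat (Gamma Gamma' : path2 M)
    (e : composable (ord_max : 'I_2) Gamma Gamma') :
  hol_surface (vconcat e) = (hol_surface Gamma * hol_surface Gamma')%g.
Proof.
rewrite -[RHS]/(glm1q_mul _ _) glm1q_mulE; apply/glm1_classP.
rewrite -[X in exact_deg2 X]/(surface_value (vconcat e) -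
  glm1_op (surface_value Gamma) (surface_value Gamma')).
rewrite glm1_op_surface !surface_valueE.
have -> : hol_path (path2_top (vconcat e)) = hol_path (path2_top Gamma').
  apply: hol_path_ext => t ht; rewrite !path_at_slice//.
  by rewrite vconcat_hi; [congr path2_at; ring|done|lra].
(* Both edges are the composite at height 1/2, read from its two halves. *)
have -> : hol_path (path2_bottom Gamma') = hol_path (path2_top Gamma).
  apply: hol_path_ext => t ht; rewrite !path_at_slice//.
  have := vconcat_hi _ _ e t (2^-1) ht; rewrite vconcat_lo//; last by lra.
  rewrite divff ?pnatr_eq0// subrr => -> //; lra.
(* With h and h' the holonomies of the two top edges, W h (h^-1 h') + W' h' = (W + W') h', so the
   claim is the vertical prism relation composed with h'. *)
rewrite comp_gl0M mulVKg opprD addrA -!comp_lfunNl -!comp_lfunDl.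
by apply: exact_deg2_compr; [exact: gl0_deg|exact: gl0_comm|exact: exact_vconcat].
Qed.

Lemma hol_path_top_hconcat (Gamma Gamma' : path2 M)
    (e : composable ord0 Gamma Gamma') :
  hol_path (path2_top (hconcat e)) =
  (hol_path (path2_top Gamma') * hol_path (path2_top Gamma))%g.
Proof.
have top_at (G : path2 M) c x : on_side ord0 c x -> path2_top G x = path2_at G c 1.
  move=> xc; rewrite /path2_top pull_at /path2_at; congr cube_at.
  by rewrite /= /slice_map xc.
have e' : composable ord0 (path2_top Gamma) (path2_top Gamma').
  move=> x y /top_at-> /top_at-> _.
  have := hconcat_hi _ _ e (2^-1) 1; rewrite hconcat_lo; [|lra|lra].
  by rewrite divff ?pnatr_eq0// subrr => -> //; lra.
rewrite -(hol_path_concat _ _ e'); apply: hol_path_ext => t ht.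
rewrite path_at_slice//; have [lo|hi] := leP t 2^-1.
  by rewrite hconcat_lo ?path_concat_lo ?path_at_slice//; lra.
by rewrite hconcat_hi ?path_concat_hi ?path_at_slice//; lra.
Qed.

Lemma hol_surface_hconcat (Gamma Gamma' : path2 M)
    (e : composable ord0 Gamma Gamma') :
  hol_surface (hconcat e) =
  (GL_act (hol_path (path2_bottom Gamma))^-1 (hol_surface Gamma') *
   hol_surface Gamma)%g.
Proof.
rewrite GL_actE -[RHS]/(glm1q_mul _ _) glm1q_mulE; apply/glm1_classP.
rewrite -[X in exact_deg2 X]/(surface_value (hconcat e) -
  glm1_op (glm1_act (hol_path (path2_bottom Gamma))^-1%g (surface_elt Gamma'))
          (surface_value Gamma)).
rewrite glm1_op_surface -[glm1_val (glm1_act _ _)]/(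
  ((hol_path (path2_bottom Gamma))^-1%g \o surface_value Gamma') \o
  (hol_path (path2_bottom Gamma))^-1^-1%g)%VF.
rewrite !surface_valueE hol_path_top_hconcat.
set b := hol_path (path2_bottom Gamma); set t := hol_path (path2_top Gamma).
set t' := hol_path (path2_top Gamma').
have bV : gl0_val b^-1%g = B1 ((path2_at Gamma)^~ 0) by exact: hol_path_slice.
have t'V : gl0_val t'^-1%g = B1 ((path2_at Gamma')^~ 1) by exact: hol_path_slice.
have := exact_hconcat beta hbeta Gamma Gamma' e; rewrite -bV -t'V.
move: (W (path2_at (hconcat e))) (W (path2_at Gamma)) (W (path2_at Gamma')) => x y y'.
(* The prism relation is composed on the right with [t' * t], the holonomy of the top edge of the
   composite. Then y t'^-1 t' t = y t, and in the goal the factor b of the conjugation action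
   cancels against the b^-1 of delta. *)
move/(exact_deg2_compr (gl0_deg (t' * t)%g) (gl0_comm (t' * t)%g)).
rewrite !comp_lfunDl !comp_lfunNl (comp_gl0M y) mulKg.
rewrite comp_gl0M mulKg opprD addrA !comp_lfunA; exact.
Qed.

Definition truncation : two_groupoid_rep M (GL V) :=
  @TwoGroupoidRep R M (GL V) hol_path hol_surface hol_path_const hol_surface_const
    hol_surface_homotopy hol_surface_delta hol_path_concat hol_surface_vconcat
    hol_surface_hconcat.

End Representation.

Local Close Scope classical_set_scope.

Theorem proposition4p6 (R : realType) (M : smooth_manifold R)
    (V : cochain_complex R) (beta : rep_up_to_homotopy M V)
    (hbeta : well_behaved beta) :
  exists T : two_groupoid_rep M (GL V),
    (forall gamma : path1 M,
      gl0_val (hol1 T gamma) = beta 1%N (path_simplex (path_inv gamma))) /\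
    (forall Gamma : path2 M, exists s : glm1' V,
      hol2 T Gamma = glm1_class s /\
      glm1_val s =
        ((beta 2%N (path2_b Gamma) - beta 2%N (path2_a Gamma))
           \o beta 1%N (path_simplex (path_inv (path2_top Gamma))))%VF).
Proof.
exists (truncation beta hbeta); split=> // Gamma.
by exists (surface_elt beta hbeta Gamma).
Qed.
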